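(* Let $\mathcal G$ be a class of finitely generated groups that is closed under the operation of isometric amalgamation along finitely generated free groups. Then every $G\in\mathcal G$ can be quasi-isometrically embedded in a group $\widehat G\in\mathcal G$ that has no proper subgroups of finite index; that is, there exist $\widehat G\in\mathcal G$ with no proper subgroup of finite index and an injective homomorphism $G\hookrightarrow\widehat G$ that is a quasi-isometric embedding with respect to word metrics associated to finite generating sets.
   Context: Isometrically embedded subgroup: let $H\subset G$ be a pair of groups with fixed finite generating sets. If the corresponding word metrics satisfy $d_G(h,h')=d_H(h,h')$ for all $h,h'\in H$, then $H$ is said to be isometrically embedded in $G$. Isometric amalgamation: consider a finite (connected) graph of groups in the sense of Serre. If one can simultaneously choose finite generating sets for all the vertex groups $G_i$ and all the edge groups $H_{i,j}$ (one fixed choice for each vertex group and for each edge group) such that the inclusions of the edge groups into the adjacent vertex groups are all isometric embeddings, then the fundamental group $\Gamma$ of the graph of groups is said to be obtained by an isometric amalgamation of the $G_i$ along the $H_{i,j}$. Loops in the graph (HNN extensions) and trivial edge groups are allowed. $\mathcal G$ is closed under isometric amalgamation along finitely generated free groups if, whenever $\Gamma$ is obtained by an isometric amalgamation in which all vertex groups belong to $\mathcal G$ and all edge groups are finitely generated free groups (including the trivial group), $\Gamma$ belongs to $\mathcal G$. Classes of groups are understood to be closed under isomorphism. *)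

(* Defs.v *)
From HB Require Import structures.
From mathcomp Require Import all_boot all_order all_algebra.
From mathcomp Require Import boolp classical_sets cardinality reals.

Set Implicit Arguments.
Unset Strict Implicit.
Unset Printing Implicit Defensive.

Import Order.TTheory GRing.Theory Num.Theory.

Local Open Scope group_scope.
Local Open Scope quotient_scope.

(* [groupType] is not restricted to finite groups. The choice structure it
   carries exists on every type by [gen_choiceMixin] and is ignored by
   isomorphisms, so no abstract group is left out. *)
Definition isomorphic (G H : groupType) : Prop :=
  exists f : {multiplicative G -> H}, bijective f.

(* ** Groups given by generators and relations *)

(* The group with generators the letters [x : L] and relations [u = v] for
   [R u v]; the letter [inv x] is made inverse to [x], so that words need no
   further formal inverses. *)
Section Presentation.
Variables (L : choiceType) (inv : L -> L) (R : seq L -> seq L -> Prop).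

Inductive word_cong : seq L -> seq L -> Prop :=
| WordRel u v of R u v : word_cong u v
| WordMulV x : word_cong [:: x; inv x] [::]
| WordVMul x : word_cong [:: inv x; x] [::]
| WordRefl u : word_cong u u
| WordSym u v of word_cong u v : word_cong v u
| WordTrans u v w of word_cong u v & word_cong v w : word_cong u w
| WordCat u u' v v' of word_cong u u' & word_cong v v' :
    word_cong (u ++ v) (u' ++ v').

Definition word_congb : rel (seq L) := fun u v => `[< word_cong u v >].

Lemma word_congb_refl : reflexive word_congb.
Proof. by move=> u; apply/asboolP; apply: WordRefl. Qed.

Lemma word_congb_sym : symmetric word_congb.
Proof. by move=> u v; apply/asboolP/asboolP; apply: WordSym. Qed.

Lemma word_congb_trans : transitive word_congb.
Proof.
by move=> v u w /asboolP uv /asboolP vw; apply/asboolP; apply: WordTrans uv vw.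
Qed.

Canonical word_congb_equiv :=
  EquivRel word_congb word_congb_refl word_congb_sym word_congb_trans.

Definition presented := {eq_quot word_congb_equiv}.
HB.instance Definition _ := Choice.on presented.

Definition presented_class (u : seq L) : presented := \pi_presented u.

Lemma presented_classP u v :
  presented_class u = presented_class v <-> word_cong u v.
Proof.
rewrite /presented_class; split; last by move=> uv; apply/eqmodP/asboolP.
by move/eqmodP/asboolP.
Qed.

Lemma presented_reprK : cancel repr presented_class.
Proof. exact: reprK. Qed.

Lemma repr_class u : word_cong (repr (presented_class u)) u.
Proof. by apply/presented_classP; rewrite presented_reprK. Qed.

Definition word_inv (u : seq L) := rev (map inv u).

Lemma word_mulV u : word_cong (u ++ word_inv u) [::].
Proof.
elim: u => [|x u IHu]; first exact: WordRefl.
have -> : (x :: u) ++ word_inv (x :: u) =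
    [:: x] ++ (u ++ word_inv u) ++ [:: inv x].
  by rewrite /word_inv /= rev_cons -cats1 catA.
apply: WordTrans (WordMulV x).
exact: WordCat (WordRefl [:: x]) (WordCat IHu (WordRefl [:: inv x])).
Qed.

Lemma word_Vmul u : word_cong (word_inv u ++ u) [::].
Proof.
elim: u => [|x u IHu]; first exact: WordRefl.
have -> : word_inv (x :: u) ++ x :: u = word_inv u ++ [:: inv x; x] ++ u.
  by rewrite /word_inv /= rev_cons -cats1 -catA.
apply: WordTrans IHu.
exact: WordCat (WordRefl (word_inv u)) (WordCat (WordVMul x) (WordRefl u)).
Qed.

Definition presented_mul (a b : presented) := presented_class (repr a ++ repr b).
Definition presented_one := presented_class [::].
Definition presented_inv (a : presented) := presented_class (word_inv (repr a)).

Lemma presented_mulA : associative presented_mul.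
Proof.
move=> a b c; apply/presented_classP.
apply: WordTrans (_ : word_cong _ (repr a ++ (repr b ++ repr c))) _.
  by apply: WordCat; [exact: WordRefl | exact: repr_class].
rewrite catA; apply: WordSym.
by apply: WordCat; [exact: repr_class | exact: WordRefl].
Qed.

Lemma presented_mul1 : left_id presented_one presented_mul.
Proof.
move=> a; rewrite -[RHS]presented_reprK; apply/presented_classP.
rewrite -[X in word_cong _ X]/([::] ++ repr a).
by apply: WordCat; [exact: repr_class | exact: WordRefl].
Qed.

Lemma presented_mulr1 : right_id presented_one presented_mul.
Proof.
move=> a; rewrite -[RHS]presented_reprK; apply/presented_classP.
rewrite -[X in word_cong _ X]cats0.
by apply: WordCat; [exact: WordRefl | exact: repr_class].
Qed.

Lemma presented_mulV : left_inverse presented_one presented_inv presented_mul.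
Proof.
move=> a; apply/presented_classP; apply: WordTrans (word_Vmul (repr a)).
by apply: WordCat; [exact: repr_class | exact: WordRefl].
Qed.

Lemma presented_mulrV : right_inverse presented_one presented_inv presented_mul.
Proof.
move=> a; apply/presented_classP; apply: WordTrans (word_mulV (repr a)).
by apply: WordCat; [exact: WordRefl | exact: repr_class].
Qed.

HB.instance Definition _ := isGroup.Build presented
  presented_mulA presented_mul1 presented_mulr1 presented_mulV presented_mulrV.

Lemma presented_classM u v :
  presented_class (u ++ v) = presented_class u * presented_class v.
Proof.
apply/presented_classP; apply: WordSym.
by apply: WordCat; exact: repr_class.
Qed.

End Presentation.

Definition free_group (n : nat) : groupType :=
  presented (fun x : 'I_n * bool => (x.1, ~~ x.2)) (fun _ _ => False).

Definition fg_free (G : groupType) : Prop :=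
  exists n : nat, isomorphic (free_group n) G.

(* ** Word metrics *)

Definition is_word (G : groupType) (S w : seq G) : bool :=
  all (fun x => (x \in S) || (x^-1 \in S)) w.

Definition generates (G : groupType) (S : seq G) : Prop :=
  forall g : G, exists2 w, is_word S w & \prod_(x <- w) x = g.

Record genset (G : groupType) := GenSet {
  genset_seq :> seq G;
  genset_generates : generates genset_seq
}.

Definition finitely_generated (G : groupType) : Prop := inhabited (genset G).

Definition has_word (G : groupType) (S : seq G) (g : G) : pred nat :=
  fun n => `[< exists w, [/\ is_word S w, \prod_(x <- w) x = g & size w = n] >].

Lemma has_word_ex (G : groupType) (S : genset G) (g : G) :
  exists n, has_word S g n.
Proof.
by have [w Sw wg] := genset_generates S g; exists (size w); apply/asboolP; exists w.
Qed.

Definition word_length (G : groupType) (S : genset G) (g : G) : nat :=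
  ex_minn (has_word_ex S g).

Definition word_dist (G : groupType) (S : genset G) (g h : G) : nat :=
  word_length S (g^-1 * h).

Definition isometric_embedding (G H : groupType) (SG : genset G) (SH : genset H)
    (f : G -> H) : Prop :=
  forall g g' : G, word_dist SH (f g) (f g') = word_dist SG g g'.

(* Since any two word metrics on a finitely generated group are bi-Lipschitz
   equivalent, it does not matter which finite generating sets are taken; here
   all of them are. *)
Definition quasi_isometric_embedding (R : realType) (G H : groupType)
    (f : G -> H) : Prop :=
  forall (SG : genset G) (SH : genset H),
  exists lambda epsilon : R, [/\ (1 <= lambda)%R, (0 <= epsilon)%R &
    forall g g' : G,
      (lambda^-1 * (word_dist SG g g')%:R - epsilon
         <= (word_dist SH (f g) (f g'))%:R
         <= lambda * (word_dist SG g g')%:R + epsilon)%R].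

(* ** Subgroups of finite index *)

Definition lcosets (G : groupType) (H : set G) : set (set G) :=
  [set [set g * h | h in H]%classic | g in [set: G]%classic]%classic.

Definition no_proper_finite_index_subgroup (G : groupType) : Prop :=
  forall H : set G, group_closed [in H] -> finite_set (lcosets H) ->
  H = [set: G]%classic.

(* ** Graphs of groups *)

(* Each geometric edge of the graph is listed once, with an orientation; loops
   and multiple edges are allowed. *)
Record graph_of_groups := GraphOfGroups {
  vertex : finType;
  edge : finType;
  src : edge -> vertex;
  tgt : edge -> vertex;
  vgroup : vertex -> groupType;
  egroup : edge -> groupType;
  src_emb : forall e : edge, {multiplicative egroup e -> vgroup (src e)};
  tgt_emb : forall e : edge, {multiplicative egroup e -> vgroup (tgt e)};
  src_emb_inj : forall e : edge, injective (src_emb e);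
  tgt_emb_inj : forall e : edge, injective (tgt_emb e)
}.

Section FundamentalGroup.
Variable X : graph_of_groups.

(* [(e, true)] is [e] with its given orientation, [(e, false)] its reverse. *)
Definition origin (a : edge X * bool) : vertex X :=
  if a.2 then src a.1 else tgt a.1.
Definition terminus (a : edge X * bool) : vertex X :=
  if a.2 then tgt a.1 else src a.1.

Definition adjacent_in (T : {set edge X}) : rel (vertex X) :=
  fun u v => [exists a, [&& a.1 \in T, origin a == u & terminus a == v]].

(* A circuit passes through distinct vertices and distinct geometric edges;
   those of length 1 are loops, those of length 2 are pairs of parallel
   edges. *)
Definition is_circuit (p : seq (edge X * bool)) : bool :=
  [&& p != [::], cycle (fun a b => terminus a == origin b) p,
      uniq (map origin p) & uniq (map fst p)].

Definition maximal_tree (T : {set edge X}) : Prop :=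
  [/\ (0 < #|vertex X|)%N,
      forall u v : vertex X, connect (adjacent_in T) u v &
      forall p, all (fun a => a.1 \in T) p -> ~~ is_circuit p].

Definition pi1_letter : choiceType :=
  ({v : vertex X & vgroup v} + edge X * bool)%type.

Definition vletter (v : vertex X) (g : vgroup v) : pi1_letter :=
  inl (Tagged (fun v => vgroup v : Type) g).
Definition eletter (e : edge X) (b : bool) : pi1_letter := inr (e, b).

Definition pi1_letter_inv (x : pi1_letter) : pi1_letter :=
  match x with
  | inl s => vletter (tagged s)^-1
  | inr a => eletter a.1 (~~ a.2)
  end.

Inductive pi1_rel (T : {set edge X}) : seq pi1_letter -> seq pi1_letter -> Prop :=
| Pi1Vertex v (g h : vgroup v) :
    pi1_rel T [:: vletter g; vletter h] [:: vletter (g * h)]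
| Pi1Edge e (h : egroup e) :
    pi1_rel T [:: eletter e true; vletter (tgt_emb e h); eletter e false]
              [:: vletter (src_emb e h)]
| Pi1Tree e of e \in T : pi1_rel T [:: eletter e true] [::].

(* Serre's fundamental group relative to a maximal tree [T]; up to isomorphism
   it does not depend on [T]. *)
Definition pi1 (T : {set edge X}) : groupType :=
  presented pi1_letter_inv (pi1_rel T).

Definition isometric_graph_of_groups : Prop :=
  exists (SV : forall v : vertex X, genset (vgroup v))
         (SE : forall e : edge X, genset (egroup e)),
  forall e : edge X,
    isometric_embedding (SE e) (SV (src e)) (src_emb e) /\
    isometric_embedding (SE e) (SV (tgt e)) (tgt_emb e).

End FundamentalGroup.

(* The existence of a maximal tree makes the graph connected. *)
Definition closed_under_free_isometric_amalgamation
    (C : groupType -> Prop) : Prop :=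
  forall (X : graph_of_groups) (T : {set edge X}),
    maximal_tree T -> isometric_graph_of_groups X ->
    (forall v : vertex X, C (vgroup v)) ->
    (forall e : edge X, fg_free (egroup e)) ->
  C (pi1 T).

(* Main.v *)
Require Import Defs.
From HB Require Import structures.
From mathcomp Require Import all_boot all_order all_algebra.
From mathcomp Require Import fingroup perm cyclic.
From mathcomp Require Import boolp classical_sets cardinality reals.
From mathcomp Require Import finmap generic_quotient zify.

Set Implicit Arguments.
Unset Strict Implicit.
Unset Printing Implicit Defensive.

Local Open Scope group_scope.

(** Why the theorem holds. A group has no proper subgroup of finite index as
soon as it has no nontrivial finite quotient. The group Ghat is obtained from
G by a short chain of isometric amalgamations along free groups, designed so
that every homomorphism from Ghat to a finite group is trivial.

Undetected elements. First G is enlarged to B = G * K, where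
  K = < z, w, t, u | zw = wz, t z^2 t^-1 = w^2, u z^2 u^-1 = z w^2 >.
In a finite quotient z has odd order: if its order were 2k, then z^(2k) = 1
would give w^(2k) = 1 through t, hence (z w^2)^k = z^k; but (z w^2)^k is
conjugate through u to z^(2k) = 1, so z^k = 1, a contradiction. Therefore z
is a power of z^2, its conjugate u z u^-1 is a power of z w^2 and commutes with
z, and the commutator [u z u^-1, z] dies ([finite_quotient_commute]). It is
nevertheless nontrivial in B: an explicit action of K on the set of pairs of
integers shows it ([undetected_extension_ex]). All edge groups used so far are
trivial or infinite cyclic, generated by elements such as z, z^2, w^2, z w^2;
those are undistorted because homomorphisms to the integers measure them
([cyclic_isometric]).

Killing everything. Next a free letter p is added: A = B * < p >. Consider the
alive elements p^4 and p x p^2, where x runs over t and the products t s with s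
a generator of B, and as many copies of the dead element p d p^-2 d p, where
d is the commutator above. If all alive elements become trivial, then all the x
are equal, so every generator s becomes trivial, then so do t and B, and
finally p, since p^4 = p^3 = 1 ([hom_kill]). Conjugating these elements by
distinct powers of u gives a basis of a free subgroup F of A. Two copies of A
are amalgamated along F by an automorphism of F exchanging alive and dead basis
elements. In a finite quotient the dead basis elements vanish in both copies,
hence the alive ones do as well, hence everything does
([hull_no_finite_quotient]).

Isometry of F. In the free product A = B * < p > the length of an element is
the number of letters p^+-1 in its normal form plus the number of those
syllables in B on which the exponent of t does not vanish. Each basis element
of F has length 4, and the conjugations by distinct powers of u, which
cost nothing, prevent any cancellation, so that a reduced word of length n in
the basis has length 4n ([conj_syl_reduced]). Adding the basis of F to the
generators of A, none of which is longer than 4, makes F and its twisted copy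
isometrically embedded. Syllables are counted with this 0-1 weight, rather than
by the letters alone: the parity of the number of letters is a homomorphism on A; it
kills the dead elements, so all basis elements would have an even number of
letters and the amalgam would have a quotient of order 2.

Metric control. G is a retract of A, so G is undistorted in A ([hnn_retract]).
A is undistorted in the amalgam because the amalgam acts on normal forms, for
which the isometry of the edge groups gives a notion of norm that each
generator changes by a bounded amount ([amalgam_base_length]). *)

(** * Actions of presented groups *)

Lemma morph_one (G H : groupType) (f : G -> H) :
  {morph f : x y / x * y} -> f 1 = 1.
Proof. by move=> fM; apply: (mulgI (f 1)); rewrite -fM !mulg1. Qed.

Section WordAction.
Variables (L : choiceType) (inv : L -> L) (R : seq L -> seq L -> Prop).
Variables (W : Type) (phi : L -> W -> W).

Definition word_act (u : seq L) (x : W) : W := foldr phi x u.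

Lemma word_act_cat u v x : word_act (u ++ v) x = word_act u (word_act v x).
Proof. by rewrite /word_act foldr_cat. Qed.

Hypothesis phiK : forall l, cancel (phi l) (phi (inv l)).
Hypothesis phiVK : forall l, cancel (phi (inv l)) (phi l).
Hypothesis phiR : forall u v, R u v -> word_act u =1 word_act v.

(** Every relation of the word congruence is generated by the free reductions
and by [R], so it is enough to check those on the letters. *)
Lemma word_act_cong u v : word_cong inv R u v -> word_act u =1 word_act v.
Proof.
elim=> {u v} [u v /phiR //|l x|l x|//|u v _ IH x|u v w _ IH1 _ IH2 x|
  u u' v v' _ IH1 _ IH2 x].
- exact: phiVK.
- exact: phiK.
- by rewrite IH.
- by rewrite IH1.
- by rewrite !word_act_cat IH1 IH2.
Qed.
End WordAction.

Definition is_left_action (G : groupType) (W : Type) (act : G -> W -> W) : Prop :=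
  act 1 =1 id /\ forall a b, act (a * b) =1 act a \o act b.

(** The universal property of a presentation, phrased for actions: this one
form serves for homomorphisms to the integers, for retractions, and for the
two actions on normal forms below. *)
Lemma presented_action (L : choiceType) (inv : L -> L)
    (R : seq L -> seq L -> Prop) (W : Type) (phi : L -> W -> W) :
    (forall l, cancel (phi l) (phi (inv l))) ->
    (forall l, cancel (phi (inv l)) (phi l)) ->
    (forall u v, R u v -> word_act phi u =1 word_act phi v) ->
  exists act : presented inv R -> W -> W,
    is_left_action act /\ forall u, act (presented_class inv R u) =1 word_act phi u.
Proof.
move=> K VK rel.
have E u x : word_act phi (repr (presented_class inv R u)) x = word_act phi u x.
  exact: (word_act_cong K VK rel (Defs.repr_class _ _ _)).
exists (fun a => word_act phi (repr a)); split=> //; split=> [x|a b x].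
  by rewrite (E [::]).
by rewrite (E (repr a ++ repr b)) word_act_cat.
Qed.

Lemma presented_prod (L : choiceType) (inv : L -> L)
    (R : seq L -> seq L -> Prop) (u : seq L) :
  presented_class inv R u = \prod_(x <- u) presented_class inv R [:: x].
Proof.
elim: u => [|x u IH]; first by rewrite big_nil.
by rewrite big_cons -IH -presented_classM.
Qed.

Section Actions.
Variables (G : groupType) (W : Type) (act : G -> W -> W).
Hypothesis actG : is_left_action act.

Lemma act_one x : act 1 x = x. Proof. by case: actG => ->. Qed.
Lemma act_mul a b x : act (a * b) x = act a (act b x).
Proof. by case: actG => _ ->. Qed.
Lemma act_K a : cancel (act a) (act a^-1).
Proof. by move=> x; rewrite -act_mul mulVg act_one. Qed.
Lemma act_VK a : cancel (act a^-1) (act a).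
Proof. by move=> x; rewrite -act_mul mulgV act_one. Qed.
End Actions.

(** * Free groups *)

Local Notation free_class n := (@presented_class ('I_n * bool)%type
  (fun x => (x.1, ~~ x.2)) (fun _ _ => False)).

Section FreeLift.
Variables (n : nat) (V : groupType) (y : 'I_n -> V).

Definition signed (G : groupType) (b : bool) (g : G) := if b then g else g^-1.

(** On words rather than on classes, so that lengths can be computed on a
reduced word chosen by [free_reduced_word]. *)
Definition free_eval (r : seq ('I_n * bool)) : V :=
  \prod_(x <- r) signed x.2 (y x.1).

Lemma free_eval_cong u v :
  word_cong (fun x => (x.1, ~~ x.2)) (fun _ _ => False) u v ->
  free_eval u = free_eval v.
Proof.
rewrite /free_eval.
elim=> {u v} [//|[i b]|[i b]|//|//|u v w _ -> _ -> //|u u' v v' _ IH1 _ IH2].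
- by rewrite big_cons big_seq1 big_nil; case: b => /=; rewrite ?mulgV ?mulVg.
- by rewrite big_cons big_seq1 big_nil; case: b => /=; rewrite ?mulgV ?mulVg.
- by rewrite !big_cat IH1 IH2.
Qed.

Definition free_lift (a : free_group n) : V := free_eval (repr a).

Lemma free_lift_class r : free_lift (free_class n r) = free_eval r.
Proof. exact/free_eval_cong/Defs.repr_class. Qed.

Lemma free_lift_mul : {morph free_lift : a b / a * b}.
Proof.
move=> a b; rewrite -[a]reprK -[b]reprK -presented_classM !free_lift_class.
by rewrite /free_eval big_cat.
Qed.

Lemma free_lift_morphism : monoid_morphism free_lift.
Proof.
by split; [apply/morph_one/free_lift_mul | apply: free_lift_mul].
Qed.

HB.instance Definition _ :=
  isUMagmaMorphism.Build (free_group n) V free_lift free_lift_morphism.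
End FreeLift.

(** * Word lengths *)

Lemma word_lengthP (G : groupType) (S : genset G) (g : G) :
  exists w, [/\ is_word S w, \prod_(x <- w) x = g & size w = word_length S g].
Proof. by rewrite /word_length; case: ex_minnP => n /asboolP. Qed.

Lemma word_length_le (G : groupType) (S : genset G) (w : seq G) :
  is_word S w -> word_length S (\prod_(x <- w) x) <= size w.
Proof.
move=> Sw; rewrite /word_length; case: ex_minnP => n _; apply.
by apply/asboolP; exists w.
Qed.

Lemma word_length0 (G : groupType) (S : genset G) (g : G) :
  word_length S g = 0%N -> g = 1.
Proof.
by have [w [_ <- <-]] := word_lengthP S g => /size0nil->; rewrite big_nil.
Qed.

Lemma word_length1 (G : groupType) (S : genset G) : word_length S 1 = 0%N.
Proof.
have := @word_length_le G S [::] isT; rewrite big_nil => h.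
by apply/eqP; rewrite -leqn0.
Qed.

Lemma is_word_cat (G : groupType) (S u v : seq G) :
  is_word S (u ++ v) = is_word S u && is_word S v.
Proof. exact: all_cat. Qed.

Lemma word_lengthM (G : groupType) (S : genset G) (g h : G) :
  word_length S (g * h) <= word_length S g + word_length S h.
Proof.
have [u [Su <- <-]] := word_lengthP S g; have [v [Sv <- <-]] := word_lengthP S h.
by rewrite -big_cat -size_cat word_length_le // is_word_cat Su.
Qed.

Lemma isometric_embedding_inj (G H : groupType) (SG : genset G) (SH : genset H)
  (f : G -> H) : isometric_embedding SG SH f -> injective f.
Proof.
move=> iso g g' fgg'; have := iso g g'; rewrite /word_dist fgg' mulVg.
rewrite word_length1 => /esym/word_length0 /eqP.
by rewrite mulg_eq1 eqg_inv => /eqP.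
Qed.

Section FreeWords.
Variable n : nat.
Notation letter := ('I_n * bool)%type.

Definition reduced (r : seq letter) : bool :=
  sorted (fun x y => ~~ ((x.1 == y.1) && (x.2 != y.2))) r.

Lemma reducedPn (r : seq letter) : ~~ reduced r ->
  exists r1 x r2, r = r1 ++ [:: x, (x.1, ~~ x.2) & r2].
Proof.
rewrite /reduced; case: r => //= x r; elim: r x => //= y r IH x.
rewrite negb_and negbK => /orP[/andP[/eqP xy1 xy2]|/IH [r1 [z [r2 ->]]]].
  exists [::], x, r; congr [:: _, _ & _].
  by move: x y xy1 xy2 => [i b] [j c] /= <-; case: b c => -[].
by exists (x :: r1), z, r2.
Qed.

Definition free_gens : seq (free_group n) :=
  [seq free_class n [:: (i, true)] | i <- enum 'I_n].

Lemma free_class_inv (i : 'I_n) :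
  free_class n [:: (i, false)] = (free_class n [:: (i, true)])^-1.
Proof.
apply/esym/mulg1_eq; rewrite -presented_classM; apply/presented_classP.
exact: (@WordMulV _ (fun x : letter => (x.1, ~~ x.2)) (fun _ _ => False) (i, true)).
Qed.

Lemma free_word (r : seq letter) :
  is_word free_gens [seq free_class n [:: x] | x <- r].
Proof.
have genS i : free_class n [:: (i, true)] \in free_gens.
  by apply/mapP; exists i; rewrite ?mem_enum.
apply/allP => g /mapP[[i b] _ ->]; case: b; first by rewrite genS.
by rewrite free_class_inv invgK genS orbT.
Qed.

Lemma free_gens_generate : generates free_gens.
Proof.
move=> a; exists [seq free_class n [:: x] | x <- repr a]; first exact: free_word.
by rewrite big_map -presented_prod presented_reprK.
Qed.

Definition free_genset := GenSet free_gens_generate.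

Lemma free_length_le (r : seq letter) :
  word_length free_genset (free_class n r) <= size r.
Proof.
rewrite presented_prod -(big_map _ xpredT id).
rewrite -(size_map (fun x => free_class n [:: x])).
exact/word_length_le/free_word.
Qed.

Lemma free_word_letters (w : seq (free_group n)) : is_word free_gens w ->
  exists2 r, free_class n r = \prod_(x <- w) x & size r = size w.
Proof.
elim: w => [|g w IH] /=; first by exists [::]; rewrite ?big_nil.
move=> /andP[gS /IH[r rE rS]]; rewrite big_cons -rE.
case/orP: gS => /mapP[i _ gi].
  by exists ((i, true) :: r); rewrite ?gi -?presented_classM //= rS.
exists ((i, false) :: r); last by rewrite /= rS.
by rewrite -[g]invgK gi -free_class_inv -presented_classM.
Qed.

(** A word of minimal length is reduced: cancelling two adjacent inverse letters
would shorten it. *)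
Lemma free_reduced_word (a : free_group n) :
  exists r, [/\ free_class n r = a, reduced r &
                size r = word_length free_genset a].
Proof.
have [w [Sw wa wn]] := word_lengthP free_genset a.
have [r ra rn] := free_word_letters Sw.
rewrite wn in rn; rewrite {}wa in ra => {w Sw wn}.
exists r; split=> //; apply/negPn/negP => /reducedPn[r1 [x [r2 rE]]].
suff: word_length free_genset a <= size (r1 ++ r2).
  by rewrite -rn rE !size_cat /=; lia.
have -> : a = free_class n (r1 ++ r2); last exact: free_length_le.
rewrite -ra rE -[_ :: _ :: r2]/([:: x; (x.1, ~~ x.2)] ++ r2) !presented_classM.
congr (_ * _); rewrite -[RHS]mul1g; congr (_ * _).
by apply/presented_classP; apply: (@WordMulV _ (fun x : letter => (x.1, ~~ x.2))).
Qed.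
End FreeWords.

(** The criterion for all edge groups. A length [l], which each generator
increases by at most [N], bounds word lengths from below by [l / N]; if it grows
by [N] with each letter of a reduced word in the [y i], those cannot be
shortened, and conversely they need no more letters because they belong to
[S]. *)
Lemma free_lift_isometric n (V : groupType) (y : 'I_n -> V) (S : genset V)
    (l : V -> nat) (N : nat) : 0 < N ->
    (forall i, y i \in (S : seq V)) ->
    (forall w, is_word S w -> l (\prod_(x <- w) x) <= N * size w) ->
    (forall r, reduced r -> N * size r <= l (free_eval y r)) ->
  isometric_embedding (free_genset n) S (free_lift y).
Proof.
move=> N0 yS lS lr g g'; rewrite /word_dist -gmulfV -gmulfM.
have [r [<- red rn]] := free_reduced_word (g^-1 * g').
rewrite -rn /= free_lift_class; apply/eqP; rewrite eqn_leq; apply/andP; split.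
  rewrite /free_eval -(big_map (fun x => signed x.2 (y x.1)) xpredT id).
  rewrite -[X in _ <= X](size_map (fun x => signed x.2 (y x.1))).
  apply: word_length_le; apply/allP => v /mapP[[i b] _ ->].
  by case: b; rewrite /= ?invgK ?yS ?orbT.
have [w [Sw wE wn]] := word_lengthP S (free_eval y r).
by rewrite -wn -(leq_pmul2l N0) (leq_trans (lr r red)) // -wE lS.
Qed.

(** * Fundamental groups of graphs of groups *)

Section Pi1.
Variables (X : graph_of_groups) (T : {set edge X}).

Notation pi1_class := (presented_class (@pi1_letter_inv X) (pi1_rel T)).

Definition pi1_incl (v : vertex X) (g : vgroup v) : pi1 T :=
  pi1_class [:: vletter g].

Definition pi1_edge (e : edge X) : pi1 T := pi1_class [:: eletter e true].

Lemma pi1_incl_morphism (v : vertex X) : monoid_morphism (@pi1_incl v).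
Proof.
have M : {morph @pi1_incl v : x y / x * y}.
  move=> g h; rewrite -presented_classM; apply/presented_classP.
  exact/WordSym/WordRel/Pi1Vertex.
by split=> //; apply: morph_one.
Qed.

HB.instance Definition _ (v : vertex X) := isUMagmaMorphism.Build
  (vgroup v) (pi1 T) (@pi1_incl v) (@pi1_incl_morphism v).

Lemma pi1_edgeV (e : edge X) : pi1_class [:: eletter e false] = (pi1_edge e)^-1.
Proof.
apply/esym/mulg1_eq; rewrite -presented_classM; apply/presented_classP.
exact: (@WordMulV _ (@pi1_letter_inv X) (pi1_rel T) (eletter e true)).
Qed.

Lemma pi1_edgeE (e : edge X) (h : egroup e) :
  pi1_edge e * pi1_incl (tgt_emb e h) = pi1_incl (src_emb e h) * pi1_edge e.
Proof.
apply: (mulIg (pi1_edge e)^-1); rewrite mulgK -pi1_edgeV -mulgA.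
transitivity (pi1_class ([:: eletter e true] ++
  ([:: vletter (tgt_emb e h)] ++ [:: eletter e false]))).
  by rewrite !presented_classM.
exact/presented_classP/WordRel/Pi1Edge.
Qed.

Lemma pi1_edge_tree (e : edge X) : e \in T -> pi1_edge e = 1.
Proof. by move=> eT; apply/presented_classP/WordRel/Pi1Tree. Qed.

Lemma pi1_ind (P : pi1 T -> Prop) :
    P 1 -> (forall a b, P a -> P b -> P (a * b)) ->
    (forall v (g : vgroup v), P (pi1_incl g)) ->
    (forall e b, P (signed b (pi1_edge e))) ->
  forall a, P a.
Proof.
move=> P1 PM PV PE a; rewrite -[a]presented_reprK.
elim: (repr a) => [//|x u IH]; rewrite -[x :: u]/([:: x] ++ u) presented_classM.
apply: PM IH; case: x => [[v g]|[e b]]; first exact: PV.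
by case: b; [apply: (PE e true) | rewrite pi1_edgeV; apply: (PE e false)].
Qed.

(** Vertex groups and edges may act on one set [W], because all vertices are
identified along the tree, whose edges must act trivially. *)
Lemma pi1_action (W : Type) (actV : forall v, vgroup v -> W -> W)
    (tau : edge X -> bool -> W -> W) :
    (forall v, is_left_action (@actV v)) ->
    (forall e b, cancel (tau e b) (tau e (~~ b))) ->
    (forall e h x,
       tau e true (actV _ (tgt_emb e h) x) = actV _ (src_emb e h) (tau e true x)) ->
    (forall e, e \in T -> tau e true =1 id) ->
  exists act : pi1 T -> W -> W,
    [/\ is_left_action act, forall v (g : vgroup v), act (pi1_incl g) =1 actV v g &
        forall e, act (pi1_edge e) =1 tau e true].
Proof.
move=> aV tauK tauE tauT.
pose phi (x : pi1_letter X) : W -> W :=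
  match x with inl s => actV _ (tagged s) | inr a => tau a.1 a.2 end.
have [||u v|act [actP actE]] :=
  @presented_action _ (@pi1_letter_inv X) (pi1_rel T) W phi.
- by case=> [[v g]|[e b]] x /=; [apply: act_K | apply: tauK].
- case=> [[v g]|[e b]] x /=; first exact: act_VK.
  by have := tauK e (~~ b) x; rewrite negbK.
- case=> {u v} [v g h x|e h x|e /tauT eT x] //=; first by rewrite act_mul.
  by rewrite tauE; have /= -> := tauK e false x.
exists act; split=> // [v g x|e x]; by rewrite actE.
Qed.

Lemma pi1_action_edgeV (W : Type) (act : pi1 T -> W -> W)
    (tau : edge X -> bool -> W -> W) (e : edge X) : is_left_action act ->
    (forall e b, cancel (tau e b) (tau e (~~ b))) ->
    act (pi1_edge e) =1 tau e true -> act (pi1_edge e)^-1 =1 tau e false.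
Proof.
move=> actP tauK actE x; apply: (can_inj (act_K actP (pi1_edge e))).
by rewrite act_VK // actE -[true]/(~~ false) tauK.
Qed.

Lemma pi1_gens_generate (S : forall v, genset (vgroup v)) :
  generates ([seq pi1_incl g | v <- enum (vertex X), g <- S v] ++
             [seq pi1_edge e | e <- enum (edge X)]).
Proof.
set s := _ ++ _.
apply: pi1_ind => [|a b [u su <-] [v sv <-]|v g|e b].
- by exists [::]; rewrite ?big_nil.
- by exists (u ++ v); rewrite ?big_cat // is_word_cat su.
- have [w Sw <-] := genset_generates (S v) g.
  exists [seq pi1_incl x | x <- w]; last first.
    by rewrite big_map -(gmulf_prod (@pi1_incl v)).
  have inS x : x \in (S v : seq _) -> pi1_incl x \in s.
    move=> xS; rewrite mem_cat; apply/orP; left.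
    by apply/flatten_mapP; exists v; rewrite ?mem_enum ?map_f.
  apply/allP => y /mapP[x xw ->].
  have /orP[/inS-> //|/inS] := allP Sw x xw.
  by rewrite (gmulfV (@pi1_incl v)) => ->; rewrite orbT.
- have es : pi1_edge e \in s by rewrite mem_cat map_f ?orbT ?mem_enum.
  exists [:: signed b (pi1_edge e)]; last by rewrite big_seq1.
  by case: b; rewrite /= ?invgK es ?orbT.
Qed.
End Pi1.

(** * Groups with stable letters *)

(** One vertex group [V] with a loop for each [i : I], whose edge group is free
of rank [n i]; the stable letter of [i] conjugates [ty i j] to [sy i j]. *)
Section Loops.
Variables (V : groupType) (I : finType) (n : I -> nat).
Variables (sy ty : forall i, 'I_(n i) -> V).
Arguments sy : clear implicits.
Arguments ty : clear implicits.
Hypothesis sinj : forall i, injective (free_lift (sy i)).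
Hypothesis tinj : forall i, injective (free_lift (ty i)).

Definition loop_graph : graph_of_groups :=
  @GraphOfGroups unit I (fun=> tt) (fun=> tt) (fun=> V) (fun i => free_group (n i))
    (fun i => free_lift (sy i)) (fun i => free_lift (ty i)) sinj tinj.

Lemma loop_graph_tree : maximal_tree (X := loop_graph) finset.set0.
Proof.
split=> [|[] []|[|a p] /=]; rewrite ?card_unit //.
by rewrite finset.in_set0.
Qed.

Definition hnn : groupType := pi1 (X := loop_graph) finset.set0.
Definition hnn_base (v : V) : hnn := @pi1_incl loop_graph _ tt v.
Definition hnn_stable (i : I) : hnn := @pi1_edge loop_graph _ i.

HB.instance Definition _ := isUMagmaMorphism.Build V hnn hnn_base
  (@pi1_incl_morphism loop_graph finset.set0 tt).

Lemma hnn_rel i j :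
  hnn_stable i * hnn_base (ty i j) = hnn_base (sy i j) * hnn_stable i.
Proof.
have := @pi1_edgeE loop_graph finset.set0 i (free_class _ [:: (j, true)]).
by rewrite /= !free_lift_class /free_eval !big_seq1.
Qed.

Lemma hnn_in (C : groupType -> Prop) (S : genset V) :
    closed_under_free_isometric_amalgamation C -> C V ->
    (forall i, isometric_embedding (free_genset (n i)) S (free_lift (sy i))) ->
    (forall i, isometric_embedding (free_genset (n i)) S (free_lift (ty i))) ->
  C hnn.
Proof.
move=> Ccl CV siso tiso; apply: Ccl => //; first exact: loop_graph_tree.
- exists (fun=> S), (fun i => free_genset (n i)) => i.
  by split; [apply: siso | apply: tiso].
- by move=> i; exists (n i), idfun; exists id.
Qed.

Lemma hnn_gens_generate (S : genset V) :
  generates ([seq hnn_base g | g <- S] ++ [seq hnn_stable i | i <- enum I]).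
Proof.
have := @pi1_gens_generate loop_graph finset.set0 (fun=> S).
have -> : enum (vertex loop_graph) = [:: tt] by rewrite enumT unlock.
by rewrite /= cats0.
Qed.

Definition hnn_genset (S : genset V) := GenSet (hnn_gens_generate S).

Lemma hnn_ind (P : hnn -> Prop) :
    P 1 -> (forall a b, P a -> P b -> P (a * b)) ->
    (forall g, P (hnn_base g)) ->
    (forall i b, P (signed b (hnn_stable i))) ->
  forall a, P a.
Proof. by move=> P1 PM PV PE; apply: pi1_ind => // -[] g. Qed.

(** Since the edge group is free, the intertwining relation is only checked on
its basis. *)
Lemma hnn_action (W : Type) (actV : V -> W -> W) (tau : I -> bool -> W -> W) :
    is_left_action actV ->
    (forall i b, cancel (tau i b) (tau i (~~ b))) ->
    (forall i j x,
       tau i true (actV (ty i j) x) = actV (sy i j) (tau i true x)) ->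
  exists act : hnn -> W -> W,
    [/\ is_left_action act, forall g, act (hnn_base g) =1 actV g,
        forall i, act (hnn_stable i) =1 tau i true &
        forall i, act (hnn_stable i)^-1 =1 tau i false].
Proof.
move=> aV tauK tauE.
have tauE' i (h : free_group (n i)) x :
    tau i true (actV (free_lift (ty i) h) x) =
    actV (free_lift (sy i) h) (tau i true x).
  rewrite -[h]presented_reprK !free_lift_class.
  elim: (repr h) x => [|[j b] r IH] x; rewrite /free_eval ?big_nil ?big_cons.
    by rewrite !act_one.
  rewrite !act_mul // -!/(free_eval _ _) -IH; case: b => /=; first exact: tauE.
  apply: (can_inj (act_K aV (sy i j))).
  by rewrite -tauE !act_VK.
have [e|act [actP actE actT]] :=
  @pi1_action loop_graph finset.set0 W (fun=> actV) tau (fun=> aV) tauK tauE'.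
  by rewrite finset.in_set0.
exists act; split=> // [g|i]; first exact: (actE tt).
exact: pi1_action_edgeV.
Qed.
End Loops.

(** * Normal forms for a stable letter *)

(** The group generated by [B] and a letter t with t a(true, e) = a(false, e) t
consists of the products v0 t^b1 v1 ... t^bn vn. Modulo moving elements
of the edge groups to the left, each vi with i > 0 can be taken among chosen
representatives of the right cosets of the image of [a bi]. The group acts on
these sequences. *)

Section NormalForms.
Variables (B E : groupType) (a : bool -> UMagmaMorphism.type E B).
Hypothesis a_inj : forall b, injective (a b).

(** The representative depends only on the coset, because [xget] depends only
on the set; it is 1 for the subgroup itself, so that pinches are visible. *)
Definition coset_rep (b : bool) (v : B) : B :=
  if `[< exists e, v = a b e >] then 1
  else xget 1 [set v' | exists e, v' = a b e * v]%classic.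

Lemma coset_rep_ex b v : exists e, v = a b e * coset_rep b v.
Proof.
rewrite /coset_rep; case: asboolP => [[e ->]|_]; first by exists e; rewrite mulg1.
case: xgetP => [v' _ [e ->]|/(_ v) []].
  by exists e^-1; rewrite gmulfV mulKg.
by exists 1; rewrite gmulf1 mul1g.
Qed.

Definition coset_part (b : bool) (v : B) : E := projT1 (cid (coset_rep_ex b v)).

Lemma coset_partK b v : a b (coset_part b v) * coset_rep b v = v.
Proof. by rewrite /coset_part; case: cid. Qed.

Lemma coset_repM b e v : coset_rep b (a b e * v) = coset_rep b v.
Proof.
rewrite /coset_rep; congr (if _ then _ else xget _ _).
  apply: asbool_equiv_eq; split=> [[f H]|[f ->]].
    by exists (e^-1 * f); rewrite gmulfM -H gmulfV mulKg.
  by exists (e * f); rewrite gmulfM.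
apply/seteqP; split=> w [f ->].
  by exists (f * e); rewrite gmulfM mulgA.
by exists (f * e^-1); rewrite gmulfM gmulfV -mulgA mulKg.
Qed.

Lemma coset_partM b e v : coset_part b (a b e * v) = e * coset_part b v.
Proof.
apply: (@a_inj b); apply: (mulIg (coset_rep b v)).
by rewrite gmulfM -mulgA coset_partK -(coset_repM b e v) coset_partK.
Qed.

Lemma coset_rep_id b v : coset_rep b (coset_rep b v) = coset_rep b v.
Proof. by rewrite -[in RHS](coset_partK b v) coset_repM. Qed.

Lemma coset_rep1 b : coset_rep b 1 = 1.
Proof.
rewrite /coset_rep; case: asboolP => [//|[]].
by exists 1; rewrite gmulf1.
Qed.

Lemma coset_part_rep b v : coset_rep b v = v -> coset_part b v = 1.
Proof.
move=> vE; apply: (@a_inj b); apply: (mulIg v).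
by rewrite gmulf1 mul1g -{2}vE coset_partK.
Qed.

(** The pair [(v0, [:: (b1, v1); ...])] stands for v0 t^b1 v1 ...; the second
condition forbids the pinches t^b 1 t^-b. *)
Definition normal (x : B * seq (bool * B)) : bool :=
  all (fun y => coset_rep y.1 y.2 == y.2) x.2 &&
  sorted (fun y z => (y.2 == 1) ==> (y.1 == z.1)) x.2.

Definition base_raw (g : B) (x : B * seq (bool * B)) := (g * x.1, x.2).

(** Multiplication by t^b on the left: v0 = a(e) r, and t^b a(e) r = a'(e) t^b r,
where t^b cancels with the next letter when r = 1 and that letter is t^-b. *)
Definition stable_raw (b : bool) (x : B * seq (bool * B)) :=
  let r := coset_rep b x.1 in let e := coset_part b x.1 in
  if x.2 is (c, r1) :: s then
    if (r == 1) && (c == ~~ b) then (a (~~ b) e * r1, s)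
    else (a (~~ b) e, (b, r) :: x.2)
  else (a (~~ b) e, [:: (b, r)]).

Lemma stable_raw_normal b x : normal x -> normal (stable_raw b x).
Proof.
case: x => [v [|[c r1] s]]; rewrite /normal /stable_raw /=.
  by rewrite coset_rep_id eqxx.
move=> /andP[/andP[r1E als] srt].
case: ifPn => [/andP[/eqP rv /eqP cb]|]; rewrite /=.
  by rewrite als /= (path_sorted srt).
rewrite coset_rep_id eqxx r1E als srt /= andbT negb_and.
by case: eqP => //= _; case: b c {r1E srt} => -[].
Qed.

Lemma stable_rawK b x : normal x -> stable_raw (~~ b) (stable_raw b x) = x.
Proof.
have push v s :
    stable_raw (~~ b) (a (~~ b) (coset_part b v), (b, coset_rep b v) :: s) = (v, s).
  rewrite /stable_raw /= -[a _ _]mulg1 coset_repM coset_partM coset_rep1 eqxx.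
  rewrite negbK eqxx /= (coset_part_rep (coset_rep1 _)) mulg1.
  by rewrite coset_partK.
case: x => [v [|[c r1] s]] nx; rewrite {2}/stable_raw /=; first by rewrite push.
case: ifPn => [/andP[/eqP rv /eqP cb]|_]; last by rewrite push.
move: nx; rewrite /normal cb /= => /andP[/andP[/eqP r1E _] srt].
rewrite /stable_raw /= coset_repM coset_partM r1E (coset_part_rep r1E) mulg1 negbK.
have vE : a b (coset_part b v) = v by rewrite -[RHS](coset_partK b) rv mulg1.
case: s srt => [|[d r2] s] /=; first by rewrite vE.
move=> /andP[+ _]; case: eqP => [-> /eqP <-|_ _] /=; last by rewrite vE.
by rewrite vE; case: b {push rv cb r1E vE}.
Qed.

Lemma stable_raw_base b e x :
  stable_raw b (base_raw (a b e) x) = base_raw (a (~~ b) e) (stable_raw b x).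
Proof.
rewrite /stable_raw /base_raw /= coset_repM coset_partM gmulfM.
by case: x.2 => [//|[c r] s]; case: ifP => //; rewrite mulgA.
Qed.

Definition nform := {x : B * seq (bool * B) | normal x}.

Definition nform_base (g : B) (x : nform) : nform :=
  Sub (base_raw g (val x)) (valP x).

Definition nform_stable (b : bool) (x : nform) : nform :=
  Sub (stable_raw b (val x)) (stable_raw_normal b (valP x)).

Definition nform1 : nform := @Sub _ _ nform (1, [::]) isT.

Lemma nform_base_action : is_left_action nform_base.
Proof.
split=> [[[v s] nx]|g h [[v s] nx]]; apply/val_inj; rewrite /= /base_raw /=.
  by rewrite mul1g.
by rewrite mulgA.
Qed.

Lemma nform_stableK b : cancel (nform_stable b) (nform_stable (~~ b)).
Proof. by move=> x; apply/val_inj; rewrite /= stable_rawK // (valP x). Qed.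

Lemma nform_stable_base b e x :
  nform_stable b (nform_base (a b e) x) = nform_base (a (~~ b) e) (nform_stable b x).
Proof. by apply/val_inj; rewrite /= stable_raw_base. Qed.
End NormalForms.

(** * Quasi-isometric embeddings *)

(** A quantity [P x m], to be read as the norm of [x] being at most [m], that each
group element increases by a bounded amount, is increased at most linearly in
the word length, because the generating set is finite. *)
Lemma action_lipschitz (G : groupType) (W : Type) (act : G -> W -> W)
    (P : W -> nat -> Prop) (S : genset G) : is_left_action act ->
    (forall x m k, (m <= k)%N -> P x m -> P x k) ->
    (forall g, exists c, forall x m, P x m -> P (act g x) (m + c)) ->
  exists c, forall g x m, P x m -> P (act g x) (m + c * word_length S g).
Proof.
move=> actP Pmono /choice[bnd bndP].
pose c := \max_(s <- (S : seq G)) maxn (bnd s) (bnd s^-1).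
have cP s : s \in (S : seq G) -> maxn (bnd s) (bnd s^-1) <= c.
  by move=> sS; rewrite /c (leq_bigmax_seq s).
exists c => g x m Pxm; have [w [Sw <- <-]] := word_lengthP S g.
elim: w Sw => [_|s w IH /andP[sS /IH {}IH]].
  by rewrite big_nil act_one // muln0 addn0.
rewrite big_cons act_mul //; apply: Pmono (bndP s _ _ IH).
rewrite /= mulnS; suff: bnd s <= c by lia.
by case/orP: sS => /cP; last rewrite invgK; lia.
Qed.

Lemma hom_lipschitz (G H : groupType) (f : {multiplicative G -> H})
    (SG : genset G) (SH : genset H) :
  exists c, forall g, word_length SH (f g) <= c * word_length SG g.
Proof.
have f1 := morph_one (@gmulfM _ _ f).
have [|||c cP] := @action_lipschitz G H (fun g x => f g * x)
    (fun x m => word_length SH x <= m) SG.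
- by split=> [x|g h x] /=; rewrite ?f1 ?mul1g // gmulfM mulgA.
- by move=> x m k mk /leq_trans; apply.
- move=> g; exists (word_length SH (f g)) => x m xm.
  by rewrite addnC (leq_trans (word_lengthM _ _ _)) ?leq_add2l.
by exists c => g; have := cP g 1 0%N; rewrite word_length1 add0n mulg1; apply.
Qed.

(** Homomorphisms are Lipschitz, so only the lower bound is in question. *)
Lemma quasi_isometric_hom (R : realType) (G H : groupType)
    (f : {multiplicative G -> H}) :
    (forall (SG : genset G) (SH : genset H), exists c, forall g,
       word_length SG g <= c * word_length SH (f g)) ->
  quasi_isometric_embedding R f.
Proof.
move=> low SG SH; have [c cP] := low SG SH; have [d dP] := hom_lipschitz f SG SH.
have f1 := morph_one (@gmulfM _ _ f).
have fV g : f g^-1 = (f g)^-1.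
  by apply/esym/mulg1_eq; rewrite -gmulfM mulgV.
pose k := (c + d).+1; exists k%:R%R, 0%R; split=> [||g h].
- by rewrite Num.Theory.ler1n.
- by [].
rewrite GRing.subr0 GRing.addr0 /word_dist -fV -gmulfM.
rewrite Num.Theory.ler_pdivrMl ?Num.Theory.ltr0n //.
rewrite -!GRing.natrM !Num.Theory.ler_nat.
apply/andP; split.
  by apply: leq_trans (cP _) _; rewrite leq_mul2r /k; lia.
by apply: leq_trans (dP _) _; rewrite leq_mul2r /k; lia.
Qed.

(** * Amalgams *)

(** Two copies of [A] amalgamated along the free subgroups with bases [y] (in the
copy [false]) and [y'] (in the copy [true]). *)
Section Amalgam.
Variables (A : groupType) (n : nat) (y y' : 'I_n -> A) (S : genset A).
Hypothesis yiso : isometric_embedding (free_genset n) S (free_lift y).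
Hypothesis yiso' : isometric_embedding (free_genset n) S (free_lift y').

Definition amalgam_graph : graph_of_groups :=
  @GraphOfGroups bool unit (fun=> false) (fun=> true) (fun=> A)
    (fun=> free_group n) (fun=> free_lift y) (fun=> free_lift y')
    (fun=> isometric_embedding_inj yiso) (fun=> isometric_embedding_inj yiso').

Lemma amalgam_graph_tree : maximal_tree (X := amalgam_graph) [set: unit].
Proof.
have adj : adjacent_in (X := amalgam_graph) [set: unit] false true /\
           adjacent_in (X := amalgam_graph) [set: unit] true false.
  by split; apply/existsP; [exists (tt, true) | exists (tt, false)];
    rewrite finset.in_setT.
split=> [|u v|p _].
- by rewrite card_bool.
- case: u v => -[]; try exact: connect0; apply: connect1; by case: adj.
apply/negP => /and4P[p0 cyc _ u].
case: p p0 cyc u => [//|[[] b] [|[[] b'] p]] _ //= .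
by case: b.
Qed.

Definition amalgam : groupType := pi1 (X := amalgam_graph) [set: unit].
Definition amalgam_incl (b : bool) (x : A) : amalgam :=
  @pi1_incl amalgam_graph _ b x.

HB.instance Definition _ b := isUMagmaMorphism.Build A amalgam (amalgam_incl b)
  (@pi1_incl_morphism amalgam_graph [set: unit] b).

Lemma amalgam_edge : @pi1_edge amalgam_graph [set: unit] tt = 1.
Proof. by rewrite pi1_edge_tree ?finset.in_setT. Qed.

Lemma amalgam_rel i : amalgam_incl true (y' i) = amalgam_incl false (y i).
Proof.
have := @pi1_edgeE amalgam_graph [set: unit] tt (free_class _ [:: (i, true)]).
by rewrite amalgam_edge mul1g mulg1 /= !free_lift_class /free_eval !big_seq1.
Qed.

Lemma amalgam_in (C : groupType -> Prop) :
  closed_under_free_isometric_amalgamation C -> C A -> C amalgam.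
Proof.
move=> Ccl CA; apply: Ccl => //; first exact: amalgam_graph_tree.
- by exists (fun=> S), (fun=> free_genset n) => e; split;
    [apply: yiso | apply: yiso'].
- by move=> i; exists n, idfun; exists id.
Qed.

Lemma amalgam_ind (P : amalgam -> Prop) :
    P 1 -> (forall a b, P a -> P b -> P (a * b)) ->
    (forall b g, P (amalgam_incl b g)) ->
  forall a, P a.
Proof.
move=> P1 PM PV; apply: pi1_ind => // -[] b; rewrite amalgam_edge.
by case: b; rewrite /= ?invg1.
Qed.

(** The amalgam acts on the normal forms over the single base [A] with a stable
letter t such that t y' t^-1 = y: the copy [false] acts as [A], the copy [true]
as t A t^-1. *)
Let emb (b : bool) : UMagmaMorphism.type (free_group n) A :=
  if b then (free_lift y' : UMagmaMorphism.type _ _)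
  else (free_lift y : UMagmaMorphism.type _ _).

Lemma emb_inj b : injective (emb b).
Proof.
by case: b;
  [apply: isometric_embedding_inj yiso' | apply: isometric_embedding_inj yiso].
Qed.

Lemma emb_length b e : word_length S (emb b e) = word_length (free_genset n) e.
Proof.
have h (z : 'I_n -> A) : isometric_embedding (free_genset n) S (free_lift z) ->
    word_length S (free_lift z e) = word_length (free_genset n) e.
  by move=> iso; have := iso 1 e; rewrite /word_dist gmulf1 !invg1 !mul1g.
by case: b; apply: h.
Qed.

(** The norm of the normal form v t^b r ... is at most [m] when the path from 1
to it can be cut at a point of each edge group crossed, the pieces having
total length at most [m]. Crossing costs nothing, as the generators of an
edge group have the same length on both sides. *)
Fixpoint reach (s : seq (bool * A)) (v : A) (m : nat) : Prop :=
  if s is (b, r) :: s' then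
    exists e k, reach s' (emb b e * r) k /\
      word_length S (v * (emb (~~ b) e)^-1) + k <= m
  else word_length S v <= m.

Lemma reach_base s v m g : reach s v m -> reach s (g * v) (m + word_length S g).
Proof.
case: s => [|[b r] s] /= => [vm|[e [k [h vm]]]].
  by rewrite addnC (leq_trans (word_lengthM _ _ _)) ?leq_add2l.
exists e, k; split=> //; rewrite -mulgA; apply: leq_trans (leq_add vm (leqnn _)).
by rewrite addnAC leq_add2r addnC word_lengthM.
Qed.

Lemma reach_mono s v m k : (m <= k)%N -> reach s v m -> reach s v k.
Proof.
case: s => [|[b r] s] /= mk => [/leq_trans|[e [l [h vm]]]]; first exact.
by exists e, l; split=> //; apply: leq_trans mk.
Qed.

Lemma reach_stable b (x : A * seq (bool * A)) m :
  reach x.2 x.1 m -> reach (stable_raw emb b x).2 (stable_raw emb b x).1 m.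
Proof.
have push v s : reach s v m -> reach ((b, coset_rep emb b v) :: s)
    (emb (~~ b) (coset_part emb b v)) m.
  move=> h; exists (coset_part emb b v), m.
  by rewrite coset_partK mulgV word_length1.
case: x => [v [|[c r] s]]; first exact: push.
rewrite /stable_raw; case: ifP => [|_]; last exact: push.
move=> /andP[/eqP /= rv /eqP ->] [e [k [h]]]; rewrite negbK.
have vE : emb b (coset_part emb b v) = v.
  by rewrite -[RHS](coset_partK emb b v) rv mulg1.
set f := coset_part _ _ _ in vE *; rewrite -vE -gmulfV -gmulfM emb_length => km.
have := reach_base (emb (~~ b) (f * e^-1)) h.
rewrite emb_length gmulfM gmulfV mulgA mulgVK.
by apply: reach_mono; rewrite addnC.
Qed.

(** An element [a] of the copy [false] maps the trivial normal form to [a]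
itself, whose norm is its word length. *)
Lemma amalgam_base_length (SH : genset amalgam) :
  exists c, forall a, word_length S a <= c * word_length SH (amalgam_incl false a).
Proof.
pose act b (a : A) : nform emb -> nform emb :=
  if b then nform_stable true \o nform_base a \o nform_stable false
  else nform_base a.
have stK b := nform_stableK emb_inj b.
have act_act b : is_left_action (act b).
  case: b; last exact: nform_base_action.
  split=> [x|g h x] /=.
    by rewrite (act_one (nform_base_action emb)) (stK false).
  by rewrite (stK true) (act_mul (nform_base_action emb)).
have [|[] h x||ac [acP acE _]] :=
  @pi1_action amalgam_graph [set: unit] (nform emb) act (fun _ _ => id) act_act.
- by [].
- by rewrite /= (nform_stable_base emb_inj true) (stK false).
- by [].
have [||c cP] := @action_lipschitz amalgam (nform emb) ac
    (fun x m => reach (val x).2 (val x).1 m) SH acP.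
- by move=> x m k; apply: reach_mono.
- apply: amalgam_ind => [|a b [k ka] [l lb]|b g].
  + by exists 0%N => x m; rewrite addn0 act_one.
  + by exists (l + k)%N => x m /lb /ka; rewrite act_mul // addnA.
  exists (word_length S g) => x m h.
  rewrite (acE b g x); case: b => /=; last exact: reach_base.
  exact/reach_stable/reach_base/reach_stable.
exists c => a; have := cP (amalgam_incl false a) (nform1 emb) 0%N.
rewrite (acE false a) /= mulg1 add0n; apply.
by rewrite word_length1.
Qed.
End Amalgam.

(** * Free products with an infinite cyclic group *)

Lemma free_group0 (a : free_group 0) : a = 1.
Proof. by rewrite -[a]presented_reprK; case: (repr a) => [//|[[]]]. Qed.

Definition no_letters (V : groupType) (i : 'I_0) : V :=
  False_rect V (elimF idP (erefl : (i < 0) = false) (ltn_ord i)).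

Lemma free_lift0_inj (V : groupType) : injective (free_lift (@no_letters V)).
Proof. by move=> a b _; rewrite [a]free_group0 [b]free_group0. Qed.

Lemma free_lift0_isometric (V : groupType) (S : genset V) :
  isometric_embedding (free_genset 0) S (free_lift (@no_letters V)).
Proof.
move=> a b; rewrite [a]free_group0 [b]free_group0 /word_dist.
by rewrite !mulVg !word_length1.
Qed.

Definition free_letter (V : groupType) : groupType :=
  @hnn V unit (fun=> 0%N) (fun=> @no_letters V) (fun=> @no_letters V)
    (fun=> @free_lift0_inj V) (fun=> @free_lift0_inj V).

Lemma free_letter_in (C : groupType -> Prop) (V : groupType) (S : genset V) :
  closed_under_free_isometric_amalgamation C -> C V -> C (free_letter V).
Proof.
move=> C_amalg CV; apply: (@hnn_in _ unit (fun=> 0%N) _ _ _ _ C S C_amalg CV).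
  by move=> _; apply: free_lift0_isometric.
by move=> _; apply: free_lift0_isometric.
Qed.

Lemma generates_cat (G : groupType) (S : genset G) (s : seq G) :
  generates (S ++ s).
Proof.
move=> g; have [w Sw <-] := genset_generates S g; exists w => //.
apply: sub_all Sw => x /orP[]; rewrite !mem_cat => ->; by rewrite ?orbT.
Qed.

Definition genset_cat (G : groupType) (S : genset G) (s : seq G) : genset G :=
  GenSet (generates_cat S s).

(** The length on B * < p > which counts the letters p^+-1 and the syllables in
[B] with a subadditive weight. *)
Section FreeLetterLength.
Variable B : groupType.
Notation A := (free_letter B).
Notation base := (hnn_base _ _ : B -> A).
Notation p := (hnn_stable _ _ tt : A).
Notation emb := (fun _ : bool => free_lift (@no_letters B)).
Notation nform := (nform emb).

Variable weight : B -> nat.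
Hypothesis weight1 : weight 1 = 0%N.
Hypothesis weightM : forall g h, weight (g * h) <= weight g + weight h.

Definition syl_len (x : B * seq (bool * B)) : nat :=
  weight x.1 + sumn [seq (weight y.2).+1 | y <- x.2].

Lemma base_len g (x : nform) :
  syl_len (val (nform_base g x)) <= weight g + syl_len (val x).
Proof. by case: x => [[v s] nx]; rewrite /syl_len /= addnA leq_add2r. Qed.

Lemma coset_rep_triv b v : coset_rep emb b v = v.
Proof.
rewrite -[RHS](coset_partK emb b v).
by rewrite [coset_part _ _ _]free_group0 gmulf1 mul1g.
Qed.

(** Whether p^b can be written in front of the normal form without
cancelling. *)
Definition pushable (b : bool) (x : B * seq (bool * B)) : bool :=
  if x.2 is (c, _) :: _ then ~~ ((x.1 == 1) && (c == ~~ b)) else true.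

Lemma stable_push b (x : B * seq (bool * B)) : pushable b x ->
  stable_raw emb b x = (1, (b, x.1) :: x.2).
Proof.
rewrite /stable_raw /pushable coset_rep_triv [coset_part _ _ _]free_group0 !gmulf1.
by case: x => [v [|[c r] s]] //= /negPf->.
Qed.

Lemma stable_len b (x : nform) :
  syl_len (val (nform_stable b x)) <=
  (syl_len (val x)).+1.
Proof.
rewrite [val (nform_stable _ _)]/=.
case: (boolP (pushable b (val x))) => [/stable_push->|].
  by rewrite /syl_len /= weight1.
rewrite /stable_raw coset_rep_triv [coset_part _ _ _]free_group0 !gmulf1.
rewrite /pushable; case: x => [[v [|[c r] s]] nx] //=.
by rewrite negbK => ->; rewrite /syl_len /= mul1g; lia.
Qed.

Lemma free_letter_act : exists act : A -> nform -> nform,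
  [/\ is_left_action act, forall g, act (base g) =1 nform_base g &
      forall b, act (signed b p) =1 @nform_stable _ _ emb b].
Proof.
have [| |i []//|act [actP actB actT actF]] := @hnn_action B unit (fun=> 0%N)
  (fun=> @no_letters B) (fun=> @no_letters B)
  (fun=> @free_lift0_inj B) (fun=> @free_lift0_inj B) nform (@nform_base _ _ emb)
  (fun=> @nform_stable _ _ emb).
- exact: nform_base_action.
- by move=> _ b; apply/nform_stableK => ?; apply: free_lift0_inj.
by exists act; split=> // -[]; [apply: actT | apply: actF].
Qed.

(** The list [(g1, b1); (g2, b2); ...] stands for g1 p^b1 g2 p^b2 ... *)
Definition syl_eval (J : seq (B * bool)) : A :=
  \prod_(x <- J) (base x.1 * signed x.2 p).

Definition syl_cost (J : seq (B * bool)) : nat :=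
  sumn [seq (weight x.1).+1 | x <- J].

Definition syl_reduced (J : seq (B * bool)) : bool :=
  sorted (fun x y => (y.1 == 1) ==> (x.2 == y.2)) J.

Section Act.
Variable act : A -> nform -> nform.
Hypothesis actP : is_left_action act.
Hypothesis actB : forall g, act (base g) =1 nform_base g.
Hypothesis actS : forall b,
  act (signed b p) =1 @nform_stable _ _ emb b.

Lemma syl_eval_len J x :
  syl_len (val (act (syl_eval J) x)) <= syl_cost J + syl_len (val x).
Proof.
elim: J => [|[g b] J IH]; rewrite /syl_eval ?big_nil ?big_cons ?act_one //.
rewrite -/(syl_eval J) !(act_mul actP) actB actS.
have := stable_len b (act (syl_eval J) x).
set y := nform_stable _ _; have := base_len g y; move: IH.
rewrite /syl_cost /=; lia.
Qed.

(** Multiplying by a word without pinches writes it in front of the normal form,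
so that lengths add up. *)
Lemma syl_eval_push g b J x : syl_reduced ((g, b) :: J) ->
    pushable (last b [seq y.2 | y <- J]) (val x) ->
  exists r s, val (act (syl_eval ((g, b) :: J)) x) = (g, (b, r) :: s) /\
    syl_len (g, (b, r) :: s) = (syl_cost ((g, b) :: J) + syl_len (val x))%N.
Proof.
elim: J g b => [|[h c] J IH] g b red push.
  exists (val x).1, (val x).2; rewrite /syl_eval big_seq1 act_mul // actB actS.
  rewrite [val _]/= stable_push // /base_raw /= mulg1; split=> //.
  by rewrite /syl_len /syl_cost /=; lia.
have /= /andP[bc redJ] := red.
have [r [s [E L]]] := IH h c redJ push.
exists h, ((c, r) :: s); rewrite /syl_eval big_cons -/(syl_eval _).
rewrite !(act_mul actP) actB actS [val _]/= stable_push; last first.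
  rewrite E /pushable /= negb_and -implybE.
  by move: bc; case: (h == 1) => //= /eqP->; case: (c).
rewrite E /base_raw /= mulg1; split=> //.
move: L; rewrite /syl_len /syl_cost /=; lia.
Qed.

Variables (n : nat) (N : nat).
Variables (c : 'I_n -> B) (J : 'I_n -> bool -> seq (B * bool)).
Hypothesis N0 : 0 < N.
Hypothesis c_inj : injective c.
Hypothesis weight_c : forall i, weight (c i) = 0%N /\ weight (c i)^-1 = 0%N.
Hypothesis JV : forall i, syl_eval (J i false) = (syl_eval (J i true))^-1.
Hypothesis J_red : forall i b, exists J',
  [/\ J i b = (1, b) :: J', syl_reduced (J i b) & last b [seq y.2 | y <- J'] = b].
Hypothesis J_cost : forall i b, syl_cost (J i b) = N.

(** Each [J i true] begins and ends with p and each [J i false] with p^-1. Since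
[c] is injective, c_i^-1 c_j separates two consecutive factors unless they are
inverse to each other. *)
Definition conj_syl (i : 'I_n) : A :=
  base (c i) * syl_eval (J i true) * (base (c i))^-1.

Lemma conj_sylE i b : signed b (conj_syl i) =
  base (c i) * syl_eval (J i b) * base (c i)^-1.
Proof.
rewrite (gmulfV base); case: b => //=.
by rewrite /conj_syl !invMg invgK JV mulgA.
Qed.

Lemma conj_syl_len i b x :
  syl_len (val (act (signed b (conj_syl i)) x)) <= N + syl_len (val x).
Proof.
rewrite conj_sylE !(act_mul actP).
set y := act _ x; have yE : syl_len (val y) <= syl_len (val x).
  by rewrite /y actB; have := base_len (c i)^-1 x; rewrite (weight_c i).2.
set z := act _ y; have : syl_len (val z) <= N + syl_len (val y).
  by have := syl_eval_len (J i b) y; rewrite J_cost.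
rewrite actB; have := base_len (c i) z; rewrite (weight_c i).1; lia.
Qed.

(** The normal form of a reduced word starts with c_i p^b for its first letter
[(i, b)], which is what the induction needs to exclude a cancellation. *)
Lemma conj_syl_reduced r : reduced r ->
  let x := val (act (free_eval conj_syl r) (nform1 emb)) in
  syl_len x = (N * size r)%N /\
  match r with
  | [::] => x = (1, [::])
  | (i, b) :: _ => exists h s, x = (c i, (b, h) :: s)
  end.
Proof.
elim: r => [|[i b] r IH] red.
  by rewrite /free_eval big_nil act_one // /syl_len /= weight1 muln0.
have {IH} [L H] := IH (path_sorted red).
rewrite /free_eval big_cons -/(free_eval _ _) conj_sylE !(act_mul actP).
set y := act (free_eval _ _) _ in L H *; clearbody y.
have [J' [JE Jr Jl]] := J_red i b; rewrite actB JE.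
rewrite JE in Jr; rewrite !actB.
have [|h [s [E {}L']]] := @syl_eval_push 1 b J' (nform_base (c i)^-1 y) Jr.
- rewrite Jl /pushable /=; case: r red L H => [|[j d] r] red _.
    by rewrite [val y]/= => ->.
  move=> [h [s ->]] /=; move: red => /= /andP[+ _]; apply: contra.
  rewrite mulg_eq1 eqg_inv => /andP[/eqP/c_inj-> /eqP->].
  by rewrite eqxx; case: b {JE Jr Jl}.
- rewrite [val _]/= E /base_raw /= mulg1; split; last by exists h, s.
  have -> : syl_len (c i, (b, h) :: s) = syl_len (1, (b, h) :: s).
    by rewrite /syl_len /= weight1 (weight_c i).1.
  rewrite L' -JE J_cost mulnS -L; congr (_ + _)%N.
  case: r {red} L H => [|[j d] r] _.
    by rewrite /syl_len /= => ->; rewrite /= mulg1 weight1 (weight_c i).2.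
  move=> [h' [s' yE]].
  change (syl_len (base_raw (c i)^-1 (val y)) = syl_len (val y)).
  have := weightM (c i)^-1 (c j).
  rewrite (weight_c i).2 (weight_c j).1 leqn0 => /eqP h2.
  by rewrite yE /syl_len /= (weight_c j).1; congr (_ + _)%N; exact: h2.
Qed.

Lemma conj_syl_isometric (S : genset A) :
    (forall s b x, s \in (S : seq A) ->
       syl_len (val (act (signed b s) x)) <= N + syl_len (val x)) ->
    (forall i, conj_syl i \in (S : seq A)) ->
  isometric_embedding (free_genset n) S (free_lift conj_syl).
Proof.
move=> Sshort YS; apply: (@free_lift_isometric _ _ _ _
  (fun a => syl_len (val (act a (nform1 emb)))) N) => // [w|r red]; last first.
  by have [<-] := conj_syl_reduced red.
elim: w => [|s w IH] /=; rewrite ?big_nil ?big_cons.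
  by rewrite act_one // /syl_len /= weight1 muln0.
case/andP => sS /IH {}IH; rewrite act_mul // mulnS.
apply: leq_trans (leq_add (leqnn N) IH).
case/orP: sS => [/Sshort h|/Sshort h]; first exact: (h true).
by have := h false; rewrite /= invgK.
Qed.
End Act.
End FreeLetterLength.

(** * Finite quotients *)

(** A subgroup of finite index contains the kernel of the permutation action on
its left cosets. *)
Lemma no_finite_quotient_subgroup (G : groupType) :
    (forall (Q : finGroupType) (f : G -> Q), {morph f : x y / x * y} ->
       forall g, f g = 1) ->
  no_proper_finite_index_subgroup G.
Proof.
move=> Gtriv H [H1 HF] /finite_fsetP[X XE].
have XP c : c \in X <-> (exists g, c = [set g * h | h in H]%classic).
  have -> : c \in X = ((c \in [set` X]%classic) : bool) by rewrite mem_setE.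
  rewrite -XE /lcosets in_setE /=; split=> [[g _ <-]|[g ->]]; first by exists g.
  by exists g.
pose mv (g : G) (c : set G) : set G := [set g^-1 * h | h in c]%classic.
have mvX g c : c \in X -> mv g c \in X.
  move=> /XP[k ->]; apply/XP; exists (g^-1 * k); apply/seteqP; split=> x /=.
    by move=> [_ [h hH <-] <-]; exists h => //; rewrite mulgA.
  by move=> [h hH <-]; exists (k * h); [exists h | rewrite mulgA].
have mvM g h c : mv (g * h) c = mv h (mv g c).
  rewrite /mv invMg; apply/seteqP; split=> x /=.
    by move=> [k kc <-]; exists (g^-1 * k); [exists k | rewrite mulgA].
  by move=> [_ [k kc <-] <-]; exists k => //; rewrite mulgA.
have mv1 c : mv 1 c = c.
  rewrite /mv invg1; apply/seteqP; split=> x /=.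
    by move=> [k kc <-]; rewrite mul1g.
  by move=> xc; exists x; rewrite ?mul1g.
pose mvf g (c : X) : X := [` mvX g (val c) (valP c)]%fset.
have mvf_inj g : injective (mvf g).
  apply: (can_inj (g := mvf g^-1)) => c; apply/val_inj.
  by rewrite /= -mvM mulgV mv1.
have := Gtriv {perm X} (fun g => perm (@mvf_inj g)) _.
have morph : {morph (fun g => perm (@mvf_inj g)) : x y / x * y}.
  move=> g h; apply/permP => c; rewrite permM !permE.
  by apply/val_inj; rewrite /= mvM.
move=> /(_ morph) triv.
have HX : H \in X.
  apply/XP; exists 1; apply/seteqP; split=> x /=.
    by move=> xH; exists x; rewrite ?mul1g.
  by move=> [h hH <-]; rewrite mul1g.
apply/seteqP; split=> // g _.
have /permP/(_ [` HX]%fset) := triv g^-1.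
rewrite permE perm1 => /(congr1 val) /= <-.
by exists 1; [rewrite -in_setE | rewrite invgK mulg1].
Qed.

(** The order of [z] is odd, since otherwise half of it would still kill [z]
through the two conjugations; so [z] is a power of [z ^+ 2]. *)
Lemma finite_quotient_commute (Q : finGroupType) (z w t u : Q) :
    commute z w -> t * z ^+ 2 = w ^+ 2 * t -> u * z ^+ 2 = (z * w ^+ 2) * u ->
  commute (u * z * u^-1) z.
Proof.
move=> zw tz uz.
have tE : (z ^+ 2) ^ t^-1 = w ^+ 2 by rewrite conjgE invgK mulgA tz mulgK.
have uE : (z ^+ 2) ^ u^-1 = z * w ^+ 2 by rewrite conjgE invgK mulgA uz mulgK.
have zodd : odd #[z].
  apply/negPn/negP => zeven; pose k := #[z]./2.
  have zk : #[z] = (2 * k)%N by rewrite mul2n /k even_halfK.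
  have z1 : (z ^+ 2) ^+ k = 1 by rewrite -expgnA -zk expg_order.
  have w1 : (w ^+ 2) ^+ k = 1 by rewrite -tE -conjXg z1 conj1g.
  have : (z * w ^+ 2) ^+ k = 1 by rewrite -uE -conjXg z1 conj1g.
  rewrite expgMn; last exact: commuteX.
  rewrite w1 mulg1 => /eqP; rewrite -order_dvdn zk => /dvdn_leq.
  have := order_gt0 z; rewrite zk; lia.
have -> : u * z * u^-1 = (z * w ^+ 2) ^+ (#[z].+1)./2.
  rewrite -uE -conjXg -expgnA mul2n even_halfK /= ?zodd //.
  by rewrite expgSr expg_order mul1g conjgE invgK mulgA.
by apply/commute_sym/commuteX/commuteM => //; apply: commuteX.
Qed.

Lemma finite_quotient_dead (A : groupType) (z w t u : A) (Q : finGroupType)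
    (f : A -> Q) : {morph f : x y / x * y} ->
    commute z w -> t * z ^+ 2 = w ^+ 2 * t -> u * z ^+ 2 = (z * w ^+ 2) * u ->
  f [~ u * z * u^-1, z] = 1.
Proof.
move=> fM zw tz uz.
have f1 := morph_one fM.
pose F : UMagmaMorphism.type A Q :=
  HB.pack f (isUMagmaMorphism.Build A Q f (f1, fM)).
rewrite -[f]/(F : A -> Q) gmulfR; apply/eqP/commgP.
rewrite !gmulfM gmulfV.
apply: (@finite_quotient_commute Q (F z) (F w) (F t) (F u)).
- by rewrite /commute -!gmulfM zw.
- by rewrite -!gmulfXn -!gmulfM tz.
- by rewrite -!gmulfXn -!gmulfM uz.
Qed.

(** * Exponents and isometric cyclic subgroups *)

(** Homomorphisms to the integers, whose group law is written additively. *)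
Definition is_degree (V : groupType) (f : V -> int) : Prop :=
  forall a b, f (a * b) = (f a + f b)%R.

Lemma degree1 (V : groupType) (f : V -> int) : is_degree f -> f 1 = 0%R.
Proof. by move=> fM; have := fM 1 1; rewrite mulg1; lia. Qed.

Lemma degreeV (V : groupType) (f : V -> int) a : is_degree f -> f a^-1 = (- f a)%R.
Proof. by move=> fM; have := fM a a^-1; rewrite mulgV degree1 //; lia. Qed.

Lemma degreeX (V : groupType) (f : V -> int) a n :
  is_degree f -> f (a ^+ n) = (f a *+ n)%R.
Proof.
move=> fM; elim: n => [|n IH]; first by rewrite expg0 degree1.
by rewrite expgS fM IH GRing.mulrS.
Qed.

Lemma degreeR (V : groupType) (f : V -> int) a b : is_degree f -> f [~ a, b] = 0%R.
Proof. by move=> fM; rewrite commgEl conjgE !fM !degreeV //; lia. Qed.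

Lemma absz_add_le (a b : int) (m n : nat) :
  `|a|%N <= m -> `|b|%N <= n -> `|(a + b)%R|%N <= m + n.
Proof. lia. Qed.

(** In rank one a reduced word is a power of the generator, which [f] measures
exactly. *)
Lemma cyclic_isometric (V : groupType) (S : genset V) (h : V) (f : V -> int)
    (N : nat) : is_degree f -> 0 < N -> f h = N%:Z%R -> h \in (S : seq V) ->
    (forall s, s \in (S : seq V) -> `|f s|%N <= N) ->
  isometric_embedding (free_genset 1) S (free_lift (fun _ : 'I_1 => h)).
Proof.
move=> fM N0 fh hS fS.
apply: (@free_lift_isometric _ _ _ _ (fun v => `|f v|%N) N) => // [w|r red].
  elim: w => [|s w IH] /=; rewrite ?big_nil ?big_cons ?degree1 //.
  case/andP => sS /IH {}IH; rewrite fM mulnS; apply: absz_add_le IH.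
  by case/orP: sS => /fS //; rewrite degreeV //; lia.
suff: f (free_eval (fun _ : 'I_1 => h) r) =
    (if r is (_, b) :: _ then (if b then 1 else -1) * (N * size r)%:Z else 0)%R.
  case: r {red} => [|[i []] r] ->; rewrite ?muln0 ?GRing.mul1r ?GRing.mulN1r ?abszN //.
elim: r red => [|[i b] r IH] red; first by rewrite /free_eval big_nil degree1.
rewrite /free_eval big_cons -/(free_eval _ _) fM (IH (path_sorted red)).
have -> : f (signed b h) = ((if b then 1 else -1) * N%:Z)%R.
  by case: b {red} => /=; rewrite ?degreeV // fh; lia.
case: r red {IH} => [|[j d] r]; first by rewrite /= muln1 GRing.addr0.
rewrite /= [i]ord1 [j]ord1 eqxx /= negbK => /andP[/eqP -> _].
by case: d; lia.
Qed.

Section Degree.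
Variables (V : groupType) (I : finType) (n : I -> nat).
Variables (sy ty : forall i, 'I_(n i) -> V).
Arguments sy : clear implicits.
Arguments ty : clear implicits.
Hypothesis sinj : forall i, injective (free_lift (sy i)).
Hypothesis tinj : forall i, injective (free_lift (ty i)).

Lemma hnn_degree (f : V -> int) (d : I -> int) : is_degree f ->
    (forall i j, f (ty i j) = f (sy i j)) ->
  exists f' : hnn sinj tinj -> int, [/\ is_degree f',
    forall v, f' (hnn_base sinj tinj v) = f v &
    forall i, f' (hnn_stable sinj tinj i) = d i].
Proof.
move=> fM fE.
have [| | |act [actP actB actS actSV]] := @hnn_action V I n sy ty sinj tinj int
  (fun v x => (f v + x)%R) (fun i b x => (if b then d i + x else - d i + x)%R).
- by split=> [x|a b x] /=; rewrite ?degree1 ?fM //; lia.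
- by move=> i b x; case: b => /=; lia.
- by move=> i j x /=; rewrite fE; lia.
have shift a x : act a x = (act a 0 + x)%R.
  elim/hnn_ind: a x => [x|a b IHa IHb x|g x|i b x].
  - by rewrite !act_one //; lia.
  - by rewrite !act_mul // IHa [in RHS]IHa IHb; lia.
  - by rewrite !actB; lia.
  - by case: b; rewrite /= ?actS ?actSV; lia.
exists (fun a => act a 0%R); split=> [a b|v|i].
- by rewrite act_mul // shift.
- by rewrite actB; lia.
- by rewrite actS; lia.
Qed.

Lemma hnn_retract (H : groupType) (r : {multiplicative V -> H}) :
    (forall i j, r (ty i j) = r (sy i j)) ->
  exists r' : {multiplicative hnn sinj tinj -> H},
    (forall v, r' (hnn_base sinj tinj v) = r v) /\
    (forall i, r' (hnn_stable sinj tinj i) = 1).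
Proof.
move=> rE; have r1 := morph_one (@gmulfM _ _ r).
have [|//||act [actP actB actS actSV]] := @hnn_action V I n sy ty sinj tinj H
  (fun v x => r v * x) (fun _ _ x => x).
- by split=> [x|a b x] /=; rewrite ?r1 ?mul1g ?gmulfM ?mulgA.
- by move=> i j x; rewrite rE.
have shift a x : act a x = act a 1 * x.
  elim/hnn_ind: a x => [x|a b IHa IHb x|g x|i b x].
  - by rewrite !(act_one actP) mul1g.
  - by rewrite !(act_mul actP) IHa [in RHS]IHa IHb mulgA.
  - by rewrite !actB mulg1.
  - by case: b; rewrite /= ?actS ?actSV mul1g.
have actM : {morph (fun a => act a 1) : a b / a * b}.
  by move=> a b; rewrite act_mul // shift.
exists (HB.pack_for {multiplicative hnn sinj tinj -> H} (fun a => act a 1)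
  (isMultiplicative.Build _ _ (fun a => act a 1) actM)).
by split=> [v|i]; rewrite /= ?actB ?actS ?mulg1.
Qed.
End Degree.

(** * An element that dies in every finite quotient *)

(** What the final construction needs of the group B = G * K of the
introduction. [ext_degree] is the exponent of t; it is nonnegative on the
generators [s], so that it does not vanish on the products t s. *)
Record undetected_extension (C : groupType -> Prop) (G : groupType) :=
  UndetectedExtension {
  ext_group : groupType;
  ext_genset : genset ext_group;
  ext_incl : {multiplicative G -> ext_group};
  ext_t : ext_group;
  ext_u : ext_group;
  ext_dead : ext_group;
  ext_degree : ext_group -> int;
  ext_in : C ext_group;
  ext_degreeP : is_degree ext_degree;
  ext_degree_t : ext_degree ext_t = 1%R;
  ext_degree_u : ext_degree ext_u = 0%R;
  ext_degree_genset : forall s, s \in (ext_genset : seq ext_group) ->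
    (0 <= ext_degree s)%R;
  ext_u_inj : injective (fun k : nat => ext_u ^+ k);
  ext_dead_neq1 : ext_dead != 1;
  ext_degree_dead : ext_degree ext_dead = 0%R;
  ext_dead_finite : forall (Q : finGroupType) (f : ext_group -> Q),
    {morph f : x y / x * y} -> f ext_dead = 1;
  ext_retract : {multiplicative ext_group -> G};
  ext_retractK : cancel ext_incl ext_retract
}.

(** A bijection of the pairs of integers, [twist false] being the inverse of
[twist true], that conjugates (x, y) -> (x + 2, y) to (x, y) -> (x + 1, y + 2).
The orbits of the former are indexed by the parity of x and by y, those of the
latter by the integer y - 2x; they are matched by sending (even, y) to -2y and
(odd, y) to 2y + 1. Without the sign the conjugate of (x, y) -> (x + 1, y) would
commute with (x, y) -> (x + 1, y). *)
Definition twist (b : bool) (x : int * int) : int * int :=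
  (if b then
    if (x.1 %% 2)%Z == 0 then ((x.1 %/ 2)%Z, 2 * (x.1 %/ 2)%Z - 2 * x.2)
    else ((x.1 %/ 2)%Z, 2 * (x.1 %/ 2)%Z + 2 * x.2 + 1)
  else
    if (x.2 %% 2)%Z == 0 then (2 * x.1, x.1 - (x.2 %/ 2)%Z)
    else (2 * x.1 + 1, (x.2 %/ 2)%Z - x.1))%R.

Lemma twistK b : cancel (twist b) (twist (~~ b)).
Proof.
case: b => -[x y]; rewrite /twist /=.
  by have [h|h] := eqVneq (x %% 2)%Z 0%R; case: eqP => /= h2; congr (_, _); lia.
by have [h|h] := eqVneq (y %% 2)%Z 0%R; case: eqP => /= h2; congr (_, _); lia.
Qed.

Lemma twist_shift x y :
  twist true (x + 2, y)%R = ((twist true (x, y)).1 + 1, (twist true (x, y)).2 + 2)%R.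
Proof.
rewrite /twist /=; case: eqP => h1; case: eqP => h2; congr (_, _) => /=; lia.
Qed.

Arguments twist : simpl never.

Section Extension.
Variables (C : groupType -> Prop) (G : groupType) (SG : genset G).
Hypothesis C_amalg : closed_under_free_isometric_amalgamation C.
Hypothesis CG : C G.

Lemma is_degree0 (V : groupType) : is_degree (fun _ : V => 0%R).
Proof. by move=> a b; rewrite GRing.addr0. Qed.

(** The free product of [G] with the free abelian group on [z] and [w], built
with a free letter [z] and then a stable letter [w] centralising it. The
generating set contains z^2, w^2 and z w^2, which both exponents bound
by 2, so that these three elements have translation length 1. *)
Lemma free_product_Z2 : exists (V : groupType) (S : genset V)
    (incl : {multiplicative G -> V}) (r : {multiplicative V -> G}) (z w : V)
    (fz fw : V -> int),
  [/\ C V, commute z w,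
      [/\ is_degree fz, fz z = 1%R & fz w = 0%R],
      [/\ is_degree fw, fw z = 0%R & fw w = 1%R] &
  [/\ [/\ cancel incl r, r z = 1 & r w = 1],
      {subset [:: z ^+ 2; w ^+ 2; z * w ^+ 2] <= (S : seq V)},
      (forall s, s \in (S : seq V) -> `|fz s|%N <= 2 /\ `|fw s|%N <= 2) &
      forall (W : Type) (actG : G -> W -> W) (tz tw : bool -> W -> W),
        is_left_action actG -> (forall b, cancel (tz b) (tz (~~ b))) ->
        (forall b, cancel (tw b) (tw (~~ b))) ->
        (forall x, tw true (tz true x) = tz true (tw true x)) ->
      exists act : V -> W -> W, [/\ is_left_action act,
        forall g, act (incl g) =1 actG g, act z =1 tz true & act w =1 tw true]]].
Proof.
pose G1 := free_letter G; pose z1 : G1 := hnn_stable _ _ tt.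
pose b1 : {multiplicative G -> G1} := hnn_base _ _.
pose S1 : genset G1 := hnn_genset _ _ SG.
have CG1 : C G1 := free_letter_in SG C_amalg CG.
have [f1 [f1M f1G f1z]] := @hnn_degree G unit (fun=> 0%N) _ _
  (fun=> @free_lift0_inj G) (fun=> @free_lift0_inj G) _ (fun=> 1%R)
  (@is_degree0 G) (fun _ _ => erefl).
have z1S : z1 \in (S1 : seq G1) by rewrite mem_cat map_f ?orbT ?mem_enum.
have S1P s : s \in (S1 : seq G1) -> (exists g, s = b1 g) \/ s = z1.
  by rewrite mem_cat => /orP[/mapP[g _ ->]|/mapP[[] _ ->]];
    [left; exists g | right].
have f1S s : s \in (S1 : seq G1) -> `|f1 s|%N <= 1.
  by move=> /S1P[[g ->]|->]; rewrite ?f1G ?f1z.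
have iso := cyclic_isometric f1M (N := 1) isT (f1z tt) z1S f1S.
have inj := isometric_embedding_inj iso.
pose V := @hnn G1 unit (fun=> 1%N) (fun _ _ => z1) (fun _ _ => z1)
  (fun=> inj) (fun=> inj).
pose b2 : {multiplicative G1 -> V} := hnn_base _ _.
pose z : V := b2 z1; pose w : V := hnn_stable _ _ tt.
pose S2 : genset V := hnn_genset _ _ S1.
have [fz [fzM fzG fzw]] := @hnn_degree G1 unit (fun=> 1%N) _ _
  (fun=> inj) (fun=> inj) _ (fun=> 0%R) f1M (fun _ _ => erefl).
have [fw [fwM fwG fww]] := @hnn_degree G1 unit (fun=> 1%N) _ _
  (fun=> inj) (fun=> inj) _ (fun=> 1%R) (@is_degree0 G1) (fun _ _ => erefl).
have [r1 [r1G r1z]] := @hnn_retract G unit (fun=> 0%N) _ _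
  (fun=> @free_lift0_inj G) (fun=> @free_lift0_inj G) G idfun (fun _ _ => erefl).
have [r2 [r2G r2w]] := @hnn_retract G1 unit (fun=> 1%N) _ _
  (fun=> inj) (fun=> inj) G r1 (fun _ _ => erefl).
exists V, (genset_cat S2 [:: z ^+ 2; w ^+ 2; z * w ^+ 2]), (b2 \o b1), r2.
exists z, w, fz, fw.
have zz : fz z = 1%R by rewrite fzG f1z.
have zw : fw z = 0%R by rewrite fwG.
have wz : fz w = 0%R by apply: fzw.
have ww : fw w = 1%R by apply: fww.
split=> //; last split.
- by apply: (@hnn_in G1 unit (fun=> 1%N) _ _ _ _ C S1 C_amalg CG1) => i; apply: iso.
- exact/esym/(hnn_rel (fun=> inj) (fun=> inj) (i := tt) ord0).
- by split=> [g||]; rewrite /= ?r2G ?r1G ?r1z ?r2w.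
- by move=> s sS; rewrite mem_cat sS orbT.
- move=> s; rewrite mem_cat => /orP[|]; last first.
    by rewrite !inE => /or3P[] /eqP->;
      rewrite ?fzM ?fwM ?degreeX // ?zz ?zw ?wz ?ww.
  rewrite mem_cat => /orP[] /mapP[g gS ->].
    rewrite fzG fwG; case/S1P: gS => [[h ->]|->]; by rewrite ?f1G ?f1z.
  by case: (g); rewrite fzw fww.
move=> W actG tz tw aG tzK twK tzw.
have [|||a1 [a1P a1G a1z _]] := @hnn_action G unit (fun=> 0%N) _ _
  (fun=> @free_lift0_inj G) (fun=> @free_lift0_inj G) W actG (fun=> tz).
- exact: aG.
- by move=> _; apply: tzK.
- by move=> i [].
have [|||a2 [a2P a2G a2w _]] := @hnn_action G1 unit (fun=> 1%N) _ _
  (fun=> inj) (fun=> inj) W a1 (fun=> tw).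
- exact: a1P.
- by move=> _; apply: twK.
- by move=> i j x /=; rewrite !a1z tzw.
exists a2; split=> // [g x|x|x].
- by rewrite /= a2G a1G.
- by rewrite a2G a1z.
- exact: a2w.
Qed.

(** Both stable letters conjugate z^2, to w^2 and to z w^2 respectively. The
commutator acts nontrivially on the pairs of integers, where [G] acts trivially,
z and w by the unit translations, t by exchanging the coordinates and u
by [twist]. *)
Lemma undetected_extension_ex : inhabited (undetected_extension C G).
Proof.
have [V [S [incl [r [z0 [w0 [fz [fw H]]]]]]]] := free_product_Z2.
case: H => CV zw0 [fzM fz1 fz0] [fwM fw0 fw1] [[rK rz rw] mS fS actV].
have z2S : z0 ^+ 2 \in (S : seq V) by apply: mS; rewrite !inE eqxx.
have w2S : w0 ^+ 2 \in (S : seq V) by apply: mS; rewrite !inE eqxx orbT.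
have zwS : z0 * w0 ^+ 2 \in (S : seq V) by apply: mS; rewrite !inE eqxx !orbT.
have isoz :
    isometric_embedding (free_genset 1) S (free_lift (fun _ : 'I_1 => z0 ^+ 2)).
  apply: (cyclic_isometric fzM (N := 2)) => // [|s /fS[]//].
  by rewrite degreeX // fz1.
pose y (b : bool) := if b then w0 ^+ 2 else z0 * w0 ^+ 2.
have isoy b :
    isometric_embedding (free_genset 1) S (free_lift (fun _ : 'I_1 => y b)).
  apply: (cyclic_isometric fwM (N := 2)) => // [||s /fS[]//].
    by rewrite /y; case: b; rewrite ?fwM ?degreeX // ?fw0 fw1.
  by case: b.
have injz := isometric_embedding_inj isoz.
have injy b := isometric_embedding_inj (isoy b).
pose A := @hnn V bool (fun=> 1%N) (fun b _ => y b) (fun _ _ => z0 ^+ 2)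
  injy (fun=> injz).
pose base : {multiplicative V -> A} := hnn_base _ _.
pose st b : A := hnn_stable _ _ b.
have deg (d : bool -> int) : exists f : A -> int, [/\ is_degree f,
    forall v, f (base v) = 0%R & forall b, f (st b) = d b].
  have [f [fM fV fE]] := @hnn_degree V bool _ _ _ injy (fun=> injz) _ d
    (@is_degree0 V) (fun _ _ => erefl).
  by exists f.
have [ft [ftM ftV ftE]] := deg (fun b => if b then 1 else 0)%R.
have [fu [fuM fuV fuE]] := deg (fun b => if b then 0 else 1)%R.
pose z := base z0; pose w := base w0; pose t := st true; pose u := st false.
have zw : commute z w by rewrite /commute /z /w -!gmulfM zw0.
have bX (x : V) n : base (x ^+ n) = base x ^+ n.
  exact: (gmulfXn (hnn_base injy (fun=> injz))).
have tz : t * z ^+ 2 = w ^+ 2 * t.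
  by rewrite -!bX; exact: (hnn_rel injy (fun=> injz) (i := true) ord0).
have uz : u * z ^+ 2 = (z * w ^+ 2) * u.
  rewrite -!bX -gmulfM; exact: (hnn_rel injy (fun=> injz) (i := false) ord0).
have rX (x : V) n : r x = 1 -> r (x ^+ n) = 1.
  move=> rx; elim: n => [|n IH]; first exact: (morph_one (@gmulfM _ _ r)).
  by rewrite expgS gmulfM rx mul1g.
have rE b (j : 'I_1) : r (z0 ^+ 2) = r (y b).
  by rewrite rX // /y; case: b; [rewrite rX | rewrite gmulfM rX // rz mulg1].
have [rA [rAV _]] := @hnn_retract V bool (fun=> 1%N) _ _ injy (fun=> injz) G r rE.
split; apply: (@UndetectedExtension C G A (hnn_genset injy (fun=> injz) S)
  (base \o incl) t u [~ u * z * u^-1, z] ft) => //.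
- by apply: (@hnn_in V bool (fun=> 1%N) _ _ _ _ C S C_amalg CV) => i;
    [apply: isoy | apply: isoz].
- exact: ftE.
- exact: ftE.
- move=> s; rewrite mem_cat => /orP[] /mapP[g _ ->]; rewrite ?ftV ?ftE //.
  by case: (g).
- by move=> k l /= /(congr1 fu); rewrite !degreeX // fuE; lia.
- apply/eqP => /eqP/commgP.
  have [|b|b|x|a1 [a1P a1G a1z a1w]] := actV (int * int)%type (fun _ x => x)
    (fun b x => (x.1 + (if b then 1 else -1), x.2)%R)
    (fun b x => (x.1, x.2 + (if b then 1 else -1))%R).
  + by [].
  + by move=> [x1 x2]; case: b => /=; congr (_, _); lia.
  + by move=> [x1 x2]; case: b => /=; congr (_, _); lia.
  + by [].
  have [//||b j [x1 x2]|a2 [a2P a2V a2S a2F]] := @hnn_action V bool (fun=> 1%N) _ _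
      injy (fun=> injz) _ a1
      (fun b => if b then fun _ x => (x.2, x.1) else twist).
  + by case=> [] b; [case | apply: twistK].
  + rewrite expg2 act_mul // !a1z.
    case: b; rewrite /y ?expg2 ?act_mul // ?a1z ?a1w /=.
      by congr (_, _); lia.
    by rewrite -!GRing.addrA; apply: twist_shift.
  (* u z u^-1 z sends (0, 0) to (1, 5), and z u z u^-1 sends it to (1, 1) *)
  move=> /(congr1 (fun a => a2 a (0, 0)%R)).
  by rewrite !(act_mul a2P) !a2S !a2F !a2V !a1z.
- exact: degreeR.
- by move=> Q f fM; apply: finite_quotient_dead zw tz uz.
by move=> g; apply: etrans (rAV (incl g)) (rK g).
Qed.
End Extension.

Lemma hom_conj_eq1 (A Q : groupType) (f : UMagmaMorphism.type A Q) a b :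
  (f (a * b * a^-1) == 1) = (f b == 1).
Proof.
rewrite !gmulfM gmulfV divg_eq1 -[X in _ == X]mulg1.
exact: (inj_eq (@mulgI _ _)).
Qed.

(** * The amalgam of two copies *)

Section Hull.
Variables (C : groupType -> Prop) (G : groupType).
Variable X : undetected_extension C G.

Notation B := (ext_group X).
Notation t := (ext_t X).
Notation u := (ext_u X).
Notation dead := (ext_dead X).
Notation A := (free_letter B).
Notation base := (hnn_base _ _ : B -> A).
Notation p := (hnn_stable _ _ tt : A).

Definition syl_weight (b : B) : nat := ext_degree b != 0%R.

Lemma syl_weight1 : syl_weight 1 = 0%N.
Proof. by rewrite /syl_weight (degree1 (@ext_degreeP _ _ X)). Qed.

Lemma syl_weightM g h : syl_weight (g * h) <= syl_weight g + syl_weight h.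
Proof. rewrite /syl_weight (@ext_degreeP _ _ X); lia. Qed.

Lemma syl_weightV g : syl_weight g^-1 = syl_weight g.
Proof. rewrite /syl_weight (degreeV _ (@ext_degreeP _ _ X)); lia. Qed.

Lemma base1 : base 1 = 1. Proof. exact: (gmulf1 (s := hnn_base _ _)). Qed.
Lemma baseV g : base g^-1 = (base g)^-1. Proof. exact: (gmulfV (hnn_base _ _)). Qed.

Definition alive_syl (x : B) (b : bool) : seq (B * bool) :=
  if b then [:: (1, true); (x, true); (1, true)]
  else [:: (1, false); (1, false); (x^-1, false)].

Definition letter_syl (b : bool) : seq (B * bool) := nseq 4 (1, b).

Definition dead_syl (b : bool) : seq (B * bool) :=
  if b then [:: (1, true); (dead, false); (1, false); (dead, true)]
  else [:: (1, false); (dead^-1, true); (1, true); (dead^-1, false)].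

(** The hypotheses of [conj_syl_isometric] on one basis element, at the common
length 4. *)
Definition good_syl (J : bool -> seq (B * bool)) : Prop :=
  syl_eval (J false) = (syl_eval (J true))^-1 /\
  forall b, (exists J', [/\ J b = (1, b) :: J', syl_reduced (J b)
      & last b [seq y.2 | y <- J'] = b]) /\ syl_cost syl_weight (J b) = 4%N.

Lemma good_alive x : syl_weight x = 1%N -> good_syl (alive_syl x).
Proof.
move=> xw; split.
  rewrite /syl_eval !big_cons !big_nil /= !base1 baseV.
  by rewrite !mul1g !mulg1 !invMg !mulgA.
case; split; try by rewrite /syl_cost /= ?syl_weightV xw !syl_weight1.
  by exists [:: (x, true); (1, true)]; rewrite /syl_reduced /= !implybT.
by exists [:: (1, false); (x^-1, false)]; rewrite /syl_reduced /= !implybT.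
Qed.

Lemma good_letter : good_syl letter_syl.
Proof.
split.
  rewrite /syl_eval !big_cons !big_nil /= !base1.
  by rewrite !mul1g !mulg1 !invMg !mulgA.
move=> b; split; last by rewrite /syl_cost /= !syl_weight1.
by exists (nseq 3 (1, b)); rewrite /syl_reduced /= !eqxx !implybT.
Qed.

Lemma good_dead : good_syl dead_syl.
Proof.
have dw : syl_weight dead = 0%N by rewrite /syl_weight (ext_degree_dead X).
split.
  rewrite /syl_eval !big_cons !big_nil /= !base1 baseV.
  by rewrite !mul1g !mulg1 !invMg !invgK !mulgA.
have d1 := negPf (ext_dead_neq1 X).
case; split; try by rewrite /syl_cost /= ?syl_weightV dw !syl_weight1.
  exists [:: (dead, false); (1, false); (dead, true)].
  by rewrite /syl_reduced /= !implybT d1.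
exists [:: (dead^-1, true); (1, true); (dead^-1, false)].
by rewrite /syl_reduced /= !implybT invg_eq1 d1.
Qed.

(** The word p^4 is listed besides the words p x p^2, which only give
p^3 = 1. *)
Definition alive : seq (bool -> seq (B * bool)) :=
  letter_syl :: [seq alive_syl x | x <- t :: [seq t * s | s <- ext_genset X]].

Lemma alive_good i : good_syl (nth letter_syl alive i).
Proof.
have [|/(nth_default _)->] := ltnP i (size alive); last exact: good_letter.
case: i => [|[|i]] /= lti; first exact: good_letter.
  by apply: good_alive; rewrite /syl_weight (ext_degree_t X).
rewrite !ltnS !size_map in lti; rewrite (nth_map t) ?size_map // (nth_map t) //.
apply: good_alive; rewrite /syl_weight (@ext_degreeP _ _ X).
rewrite ext_degree_t; have := ext_degree_genset (mem_nth t lti).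
by move: (ext_degree _) => d d0; have -> : (1 + d != 0)%R by lia.
Qed.

Notation m := (size alive).

(** The first half of the basis is alive and the second half dead, so that
[swap] exchanges the two kinds. *)
Definition basis_syl (i : 'I_(m + m)) : bool -> seq (B * bool) :=
  match split i with inl j => nth letter_syl alive j | inr _ => dead_syl end.

Definition swap (i : 'I_(m + m)) : 'I_(m + m) :=
  match split i with inl j => rshift m j | inr j => lshift m j end.

Lemma swapK : involutive swap.
Proof.
move=> i; rewrite -[i]splitK /swap; case: (split i) => j /=.
  by rewrite (unsplitK (inl j)) (unsplitK (inr j)).
by rewrite (unsplitK (inr j)) (unsplitK (inl j)).
Qed.

Lemma basis_good i : good_syl (basis_syl i).
Proof.
by rewrite /basis_syl; case: split => j; [apply: alive_good | apply: good_dead].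
Qed.

Definition basis (i : 'I_(m + m)) : A :=
  conj_syl (fun i : 'I_(m + m) => u ^+ i) basis_syl i.

Definition basis_genset : genset A :=
  genset_cat (hnn_genset _ _ (ext_genset X)) [seq basis i | i <- enum 'I_(m + m)].

Lemma u_weight k : syl_weight (u ^+ k) = 0%N /\ syl_weight (u ^+ k)^-1 = 0%N.
Proof.
rewrite syl_weightV /syl_weight (degreeX _ _ (@ext_degreeP _ _ X)) (ext_degree_u X).
by rewrite GRing.mul0rn.
Qed.

Lemma basis_isometric (f : 'I_(m + m) -> 'I_(m + m)) : injective f ->
  isometric_embedding (free_genset (m + m)) basis_genset (free_lift (basis \o f)).
Proof.
move=> f_inj; have [act [actP actB actS]] := @free_letter_act B.
have good i := basis_good i.
have JV i : syl_eval (basis_syl i false) = (syl_eval (basis_syl i true))^-1.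
  by case: (good i).
have Jr i b := (proj2 (good i) b).1.
have Jc i b := (proj2 (good i) b).2.
apply: (conj_syl_isometric (weight := syl_weight) syl_weight1 syl_weightM
  actP actB actS (N := 4) isT (c := fun i => u ^+ f i) (J := basis_syl \o f)).
- by move=> i j /ext_u_inj /val_inj /f_inj.
- by move=> i; apply: u_weight.
- by move=> i; apply: JV.
- by move=> i b; apply: Jr.
- by move=> i b; apply: Jc.
- move=> s b x; rewrite mem_cat => /orP[|/mapP[i _ ->]]; last first.
    apply: (conj_syl_len syl_weight1 syl_weightM actP actB actS
      (c := fun i : 'I_(m + m) => u ^+ i) (J := basis_syl)) => //.
    by move=> j; apply: u_weight.
  rewrite mem_cat => /orP[/mapP[g _ ->]|/mapP[[] _ ->]]; last first.
    rewrite actS; apply: leq_trans (stable_len syl_weight1 _ _) _.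
    by rewrite -addn1 addnC leq_add2r.
  have -> : signed b (base g) = base (signed b g).
    by case: b; rewrite //= baseV.
  rewrite actB; apply: leq_trans (base_len syl_weightM _ _) _.
  by rewrite leq_add2r /syl_weight; case: (_ != _).
- by move=> i; rewrite mem_cat (map_f basis) ?mem_enum ?orbT.
Qed.

Lemma basis_lshift j : basis (lshift m j) =
  base (u ^+ j) * syl_eval (nth letter_syl alive j true) * (base (u ^+ j))^-1.
Proof. by rewrite /basis /conj_syl /basis_syl (unsplitK (inl j)). Qed.

Lemma basis_rshift j : basis (rshift m j) =
  base (u ^+ (m + j)) * syl_eval (dead_syl true) * (base (u ^+ (m + j)))^-1.
Proof. by rewrite /basis /conj_syl /basis_syl (unsplitK (inr j)). Qed.

Lemma hom_dead_basis (Q : finGroupType) (f : UMagmaMorphism.type A Q) j :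
  f (basis (rshift m j)) = 1.
Proof.
have fd : f (base dead) = 1.
  by apply: (ext_dead_finite (f := f \o base)) => a b; rewrite /= !gmulfM.
apply/eqP; rewrite basis_rshift hom_conj_eq1 /syl_eval !big_cons big_nil /=.
rewrite !gmulfM !gmulfV base1 gmulf1 fd !mul1g !mulg1.
by rewrite mulVKg mulVg.
Qed.

(** The words p x p^2 force t = t s for each generator s of [B]. *)
Lemma hom_kill (Q : groupType) (f : UMagmaMorphism.type A Q) :
  (forall j, f (basis (lshift m j)) = 1) -> forall a, f a = 1.
Proof.
move=> fJ.
have fE i : i < m -> f (syl_eval (nth letter_syl alive i true)) = 1.
  move=> im; have /eqP := fJ (Ordinal im); rewrite basis_lshift hom_conj_eq1 => /eqP.
  exact.
have fp : f p * (f p * (f p * f p)) = 1.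
  have := fE 0%N isT; rewrite /syl_eval !big_cons big_nil /= !gmulfM base1 gmulf1.
  by rewrite !mul1g mulg1.
have fx i : i.+1 < m -> f p * (f (base (nth t (t :: [seq t * s | s <- ext_genset X]) i))
    * (f p * f p)) = 1.
  move=> im; have := fE _ im.
  have -> : nth letter_syl alive i.+1 =
      alive_syl (nth t (t :: [seq t * s | s <- ext_genset X]) i).
    by apply: (nth_map t); move: im; rewrite /alive /= size_map.
  rewrite /syl_eval !big_cons big_nil /= !gmulfM base1 gmulf1.
  by rewrite !mul1g mulg1 !mulgA.
have ft : f p * (f (base t) * (f p * f p)) = 1 := fx 0%N isT.
have fs s : s \in (ext_genset X : seq B) -> f (base s) = 1.
  move=> sS; have im : (index s (ext_genset X)).+2 < m.
    by rewrite /= !size_map !ltnS index_mem.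
  have := fx _ im; rewrite /= (nth_map t) ?index_mem // nth_index // !gmulfM.
  move=> fts; have := etrans fts (esym ft) => /mulgI/mulIg/eqP.
  by rewrite -[X in _ == X]mulg1 => /eqP/mulgI.
have fB b : f (base b) = 1.
  have [w Sw <-] := genset_generates (ext_genset X) b.
  elim: w Sw => [|s w IH] /=; first by rewrite big_nil base1 gmulf1.
  case/andP=> sS /IH {}IH; rewrite big_cons !gmulfM IH mulg1.
  by case/orP: sS => /fs //; rewrite baseV gmulfV => /eqP; rewrite invg_eq1 => /eqP.
have f1 : f p = 1.
  have h : f p * (f p * f p) = 1 by move: ft; rewrite /= fB mul1g.
  by move: fp; rewrite h mulg1.
apply: hnn_ind => [|a b fa fb|g|[] b]; rewrite ?gmulf1 ?gmulfM ?fa ?fb ?mulg1 //.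
by case: b; rewrite /= ?gmulfV f1 ?invg1.
Qed.

Lemma swap_inj : injective swap. Proof. exact: inv_inj swapK. Qed.

Definition hull : groupType :=
  amalgam (basis_isometric (@inj_id _)) (basis_isometric swap_inj).

Definition hull_incl (b : bool) : {multiplicative A -> hull} :=
  amalgam_incl (basis_isometric (@inj_id _)) (basis_isometric swap_inj) b.

Lemma hull_no_finite_quotient : no_proper_finite_index_subgroup hull.
Proof.
apply: no_finite_quotient_subgroup => Q f fM.
have f1 := morph_one fM.
pose F : UMagmaMorphism.type hull Q :=
  HB.pack f (isUMagmaMorphism.Build hull Q f (f1, fM)).
pose h b : UMagmaMorphism.type A Q :=
  F \o amalgam_incl (basis_isometric (@inj_id _)) (basis_isometric swap_inj) b.
have rel i : h true (basis (swap i)) = h false (basis i).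
  rewrite /h /=.
  by rewrite (amalgam_rel (basis_isometric (@inj_id _)) (basis_isometric swap_inj)).
have kill b a : h b a = 1.
  apply: hom_kill => j; case: b.
    have := rel (rshift m j); rewrite hom_dead_basis.
    by rewrite /swap (unsplitK (inr j)).
  by rewrite -rel /swap (unsplitK (inl j)) hom_dead_basis.
apply: amalgam_ind => [//|a b fa fb|b g]; first by rewrite fM fa fb mulg1.
exact: (kill b g).
Qed.
End Hull.

Theorem theoremA (R : realType) (C : groupType -> Prop)
    (C_fg : forall G : groupType, C G -> finitely_generated G)
    (C_iso : forall G H : groupType, isomorphic G H -> C G -> C H)
    (C_amalg : closed_under_free_isometric_amalgamation C)
    (G : groupType) (CG : C G) :
  exists (Ghat : groupType) (f : {multiplicative G -> Ghat}),
    [/\ C Ghat, no_proper_finite_index_subgroup Ghat, injective f &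
        quasi_isometric_embedding R f].
Proof.
have [SG] := C_fg G CG.
have [X] := undetected_extension_ex SG C_amalg CG.
have C_base := free_letter_in (ext_genset X) C_amalg (ext_in X).
pose base : {multiplicative ext_group X -> free_letter (ext_group X)} :=
  hnn_base _ _.
pose f : {multiplicative G -> hull X} := hull_incl X false \o (base \o ext_incl X).
have low (S1 : genset G) (S2 : genset (hull X)) : exists c, forall g,
    word_length S1 g <= c * word_length S2 (f g).
  have [r [rB _]] := @hnn_retract _ unit (fun=> 0%N) _ _
    (fun=> @free_lift0_inj (ext_group X)) (fun=> @free_lift0_inj (ext_group X)) G
    (ext_retract X) (fun _ _ => erefl).
  have [c cP] := hom_lipschitz r (basis_genset X) S1.
  have [d dP] := amalgam_base_length S2.
  exists (c * d)%N => g; rewrite -mulnA.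
  have <- : r (base (ext_incl X g)) = g by rewrite rB ext_retractK.
  apply: leq_trans (cP _) _; rewrite leq_mul2l; apply/orP; right.
  by rewrite rB ext_retractK; apply: dP.
exists (hull X), f; split.
- exact: amalgam_in.
- exact: hull_no_finite_quotient.
- have [S2] := C_fg _ (amalgam_in (basis_isometric (@inj_id _))
    (basis_isometric (@swap_inj _ _ X)) C_amalg C_base).
  have [c cP] := low SG S2.
  have f1 := morph_one (@gmulfM _ _ f).
  move=> g h fgh; have := cP (g^-1 * h).
  rewrite gmulfM -fgh -gmulfM mulVg f1 word_length1 muln0 leqn0 => /eqP.
  by move/word_length0/mulg1_eq; rewrite invgK.
- exact: quasi_isometric_hom.
Qed.
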